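(* Let $d$ be a positive integer, $r$ a prime, and $m \ge (r-1)d+2$. Let $P$ be an $m$-dimensional convex polytope with face diameter smaller than $\pi/r$; that is, there is a fixed homeomorphism $h:\partial P \to S^{m-1}$ such that for every proper face $F$ of $P$ the spherical diameter of $h(F)$ in $S^{m-1}$ is smaller than $\pi/r$. Then for any continuous map $f:P \to \mathbb{R}^d$ there are $r$ pairwise vertex-disjoint faces of $P$ whose images under $f$ have a common point.
   Context: $S^{m-1}$ is the unit sphere in $\mathbb{R}^m$ equipped with the spherical (geodesic) distance; the spherical diameter of a subset is the supremum of spherical distances between its points. The face diameter of $P$ is measured with respect to the fixed homeomorphism $h:\partial P\to S^{m-1}$: the diameter of a face $F$ is the spherical diameter of $h(F)$. *)

(* Defs.v *)
(* R^n is 'rV[R]_n with its product topology, for R : realType. *)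
From mathcomp Require Export all_boot all_order all_algebra.
From mathcomp Require Export all_classical all_reals all_analysis.

Set Implicit Arguments.
Unset Strict Implicit.
Unset Printing Implicit Defensive.

Export Order.TTheory GRing.Theory Num.Theory.
Export numFieldNormedType.Exports.

Local Open Scope classical_set_scope.
Local Open Scope ring_scope.

Definition dotv (R : realType) (n : nat) (x y : 'rV[R]_n) : R :=
  \sum_(i < n) x 0 i * y 0 i.

Definition affine_hull (R : realType) (n : nat) (A : set 'rV[R]_n) :
    set 'rV[R]_n :=
  [set x | exists (k : nat) (p : 'I_k -> 'rV[R]_n) (w : 'I_k -> R),
    [/\ forall i, A (p i), \sum_(i < k) w i = 1
      & x = \sum_(i < k) w i *: p i]].

Definition convex_hull (R : realType) (n : nat) (A : set 'rV[R]_n) :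
    set 'rV[R]_n :=
  [set x | exists (k : nat) (p : 'I_k -> 'rV[R]_n) (w : 'I_k -> R),
    [/\ forall i, A (p i), forall i, 0 <= w i, \sum_(i < k) w i = 1
      & x = \sum_(i < k) w i *: p i]].

Definition affinely_independent (R : realType) (n k : nat)
    (p : 'I_k -> 'rV[R]_n) : Prop :=
  forall w : 'I_k -> R, \sum_(i < k) w i = 0 ->
    \sum_(i < k) w i *: p i = 0 -> forall i, w i = 0.

Definition has_affine_dim (R : realType) (n : nat) (A : set 'rV[R]_n)
    (m : nat) : Prop :=
  exists p : 'I_m.+1 -> 'rV[R]_n,
    affinely_independent p /\ affine_hull (range p) = affine_hull A.

Definition is_polytope (R : realType) (n : nat) (P : set 'rV[R]_n) : Prop :=
  exists2 V : set 'rV[R]_n, finite_set V & P = convex_hull V.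

(* The empty set (c = 0, b = 1) and P itself (c = 0, b = 0) are faces. *)
Definition is_face (R : realType) (n : nat) (P F : set 'rV[R]_n) : Prop :=
  exists (c : 'rV[R]_n) (b : R),
    (forall x, P x -> dotv c x <= b) /\ F = [set x | P x /\ dotv c x = b].

Definition is_proper_face (R : realType) (n : nat) (P F : set 'rV[R]_n) : Prop :=
  is_face P F /\ F <> P.

Definition vertices (R : realType) (n : nat) (P : set 'rV[R]_n) :
    set 'rV[R]_n :=
  [set v | is_face P [set v]].

(* The vertices of a face F of P are the vertices of P lying in F. *)
Definition vertex_disjoint (R : realType) (n : nat)
    (P F G : set 'rV[R]_n) : Prop :=
  vertices P `&` F `&` G = set0.

Definition relative_interior (R : realType) (n : nat) (A : set 'rV[R]_n) :
    set 'rV[R]_n :=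
  [set x | A x /\ \forall y \near x, affine_hull A y -> A y].

(* The relative boundary, for closed A; P need not span the ambient R^n. *)
Definition relative_boundary (R : realType) (n : nat) (A : set 'rV[R]_n) :
    set 'rV[R]_n :=
  A `\` relative_interior A.

(* S^(m-1), as a subset of R^m. *)
Definition unit_sphere (R : realType) (m : nat) : set 'rV[R]_m :=
  [set x | dotv x x = 1].

Definition spherical_dist (R : realType) (m : nat) (x y : 'rV[R]_m) : R :=
  acos (dotv x y).

(* Real supremum: spherical_dist is at most pi on the unit sphere, and the
   library's convention sup set0 = 0 covers the empty set. *)
Definition spherical_diam (R : realType) (m : nat) (A : set 'rV[R]_m) : R :=
  sup [set spherical_dist x y | x in A & y in A].

(* The values of h off A are irrelevant. *)
Definition is_homeomorphism (T U : topologicalType) (A : set T) (B : set U)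
    (h : T -> U) : Prop :=
  [/\ set_bij A B h, {within A, continuous h}
    & exists g : U -> T,
        {within B, continuous g} /\ forall x, A x -> g (h x) = x].

(* Main.v *)
Require Import Defs.
From mathcomp Require Import ring lra zify.

Set Implicit Arguments.
Unset Strict Implicit.
Unset Printing Implicit Defensive.

(* Let [U] rotate all the coordinates of C^K by [2 pi / r], and let [G] be [f]
   transported to the sphere by the inverse of [h].  If a unit vector [x] satisfies
   [G (U^i x) = G x] for all [i], the preimages of the points [U^i x] under [h] lie in
   proper faces of [P], and a vertex common to two of these faces would be at distance
   less than [pi / r] from two points at distance at least [2 pi / r].

   Such an [x] exists because [r] is prime.  Otherwise, by compactness, for each [x]
   some coordinate of the [r] values [G (U^i x)] has a gap of definite size splitting
   the indices into a set [A] and its complement; labelling [x] by that coordinate, by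
   [#|A|] and by the sum of [A] modulo [r] yields an equivariant labelling with values
   in [Z_r x N], for [N = (r - 1) d] colours, such that nearby points of equal colour
   have equal labels.  This is excluded by a Z_r-Tucker lemma: classes generating the
   cohomology of [Z_r] over [F_r], written as cochains on words in [Z_r], are pulled
   back to a fine grid subdivision of the cells of the sphere, arranged as in the
   resolution [... -> F_r[Z_r] -> F_r[Z_r]] whose maps alternate between [g - 1] and
   the norm.  Stokes' formula forces the value in dimension [N] to be nonzero, whereas
   it vanishes because a flag of [N + 1] cells must repeat one of the [N] colours. *)

Local Open Scope ring_scope.

(** * Cochains on words *)

Section Cochains.
Variable F : zmodType.
Variable V : pzRingType.
Implicit Types (c d : seq F -> V) (l : seq F).

(** The augmented simplicial coboundary, unfolded along the first letter: words are simplices, and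
    the empty word has dimension -1. *)
Fixpoint coboundary c l : V :=
  if l is x :: l' then c l' - coboundary (fun t => c (x :: t)) l' else 0.

Definition translate (j : F) c l : V := c [seq x + j | x <- l].

(** Vanishing on degenerate simplices: flags in which a label is repeated will contribute
    nothing. *)
Definition normalized c := forall a x b, c (a ++ x :: x :: b) = 0.

Lemma eq_coboundary c d : c =1 d -> coboundary c =1 coboundary d.
Proof.
move=> cd l; elim: l c d cd => //= x l IH c d cd; rewrite cd.
by congr (_ - _); apply: IH => t.
Qed.

Lemma coboundaryB c d l :
  coboundary (fun t => c t - d t) l = coboundary c l - coboundary d l.
Proof.
elim: l c d => [|x l IH] c d /=; first by rewrite subr0.
by rewrite IH !opprB addrACA [RHS]addrACA; congr (_ + _); rewrite addrC.
Qed.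

Lemma coboundary_sum (I : finType) (c : I -> seq F -> V) l :
  coboundary (fun t => \sum_i c i t) l = \sum_i coboundary (c i) l.
Proof.
elim: l c => [|x l IH] c /=; first by rewrite big1.
by rewrite IH -sumrB.
Qed.

Lemma coboundary_translate j c l :
  coboundary (translate j c) l = translate j (coboundary c) l.
Proof.
elim: l c => //= x l IH c; rewrite [RHS]/translate /=; congr (_ - _).
exact: (IH (fun t => c (x + j :: t))).
Qed.

Lemma coboundaryK c l : coboundary (coboundary c) l = 0.
Proof.
elim: l c => //= x l IH c.
by rewrite coboundaryB IH subr0 subrr.
Qed.

(** Needed because [cell_eval] appends the label of the larger cell at the end of a word, whereas
    [coboundary] recurses from the front. *)
Lemma coboundary_rcons c l a :
  coboundary c (rcons l a) =
  coboundary (fun t => c (rcons t a)) l + (-1) ^+ size l * c l.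
Proof.
elim: l c => [|x l IH] c /=; first by rewrite expr0 mul1r subr0 add0r.
by rewrite IH opprD addrA exprS mulN1r mulNr.
Qed.

(** The two terms deleting one of the equal letters cancel; every other term keeps the pair. *)
Lemma normalized_coboundary c : normalized c -> normalized (coboundary c).
Proof.
move=> nc a; elim: a c nc => [|y a IH] c nc x b /=.
  rewrite opprB addrCA subrr addr0.
  have: (fun t => c [:: x, x & t]) =1 (fun t => 0) by move=> t; exact: (nc [::]).
  move/eq_coboundary => ->; elim: b => //= z b ->; exact: subr0.
rewrite nc sub0r IH ?oppr0 // => a' x' b'; exact: (nc (y :: a')).
Qed.

Lemma normalized_rcons c z : normalized c -> normalized (fun l => c (rcons l z)).
Proof. by move=> nc a x b; rewrite rcons_cat /= nc. Qed.

End Cochains.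

(** * Cocycles for the cohomology of Z_r *)

Section Tower.
Variable r : nat.
Hypothesis r_prime : prime r.
Local Notation F := 'F_r.
Implicit Types (c d : seq F -> F) (l : seq F).

(** Restriction to a fundamental domain: each translation orbit of nonempty words has exactly one
    member starting with 0. *)
Definition norm_primitive d l : F := (head 0 l == 0)%:R * d l.

(** A discrete antiderivative along translation orbits: partial sums of [d] from the member of the
    orbit that starts with 0. *)
Definition diff_primitive d l : F :=
  \sum_(i < val (head 0 l)) d [seq x - head 0 l + i%:R | x <- l].

Definition trace d l : F := \sum_(j : F) translate j d l.

Lemma map_add0 l : [seq x + 0 | x <- l] = l.
Proof. by rewrite -[RHS]map_id; apply: eq_map => x; rewrite addr0. Qed.

Lemma trace_norm_primitive d : (forall j l, translate j d l = d l) -> d [::] = 0 ->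
  trace (norm_primitive d) =1 d.
Proof.
move=> inv d0 [|s l]; first by rewrite /trace big1 // => j _; rewrite /translate /norm_primitive /= d0 mulr0.
rewrite /trace (bigD1 (- s)) //= big1 ?addr0.
  by rewrite -[RHS](inv (- s)) /translate /norm_primitive /= subrr eqxx mul1r.
move=> j; rewrite /translate /norm_primitive /= => jNs.
by rewrite addrC addr_eq0 (negbTE jNs) mul0r.
Qed.

(** Translating by 1 lengthens the partial sum by the term [d l]; when the first letter wraps round
    to 0, the full sum that is lost is a trace, hence zero. *)
Lemma diff_primitiveP d : (forall l, trace d l = 0) -> d [::] = 0 ->
  forall l, translate 1 (diff_primitive d) l - diff_primitive d l = d l.
Proof.
move=> tr d0 [|s l].
  by rewrite /translate /diff_primitive /= !big_ord0 subr0 d0.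
rewrite /translate /diff_primitive [head _ _]/= [head _ (s :: l)]/=.
set g := fun i : nat => d [seq x - s + i%:R | x <- s :: l].
have gs : g (val s) = d (s :: l).
  rewrite /g; congr d; rewrite -[RHS]map_id; apply: eq_map => x.
  by rewrite natr_Zp subrK.
under eq_bigr => i _.
  rewrite -map_comp (eq_map (g := fun x => x - s + i%:R)); last first.
    by move=> x /=; rewrite opprD addrACA subrr addr0.
  over.
rewrite -/(g _) (_ : \sum_(i < _) d [seq x - s + i%:R | x <- s :: l] =
   \sum_(i < val s) g i) //.
rewrite [X in X - _](_ : _ = \sum_(i < (val s).+1) g i); last first.
  (* [(Zp_trunc (pdiv r)).+2] is the modulus underlying ['F_r]. *)
  have [slt|sge] := ltnP (val s).+1 (Zp_trunc (pdiv r)).+2.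
    have -> : val (s + 1) = (val s).+1 by rewrite /= modnDmr addn1 modn_small.
    by [].
  have se : (val s).+1 = (Zp_trunc (pdiv r)).+2.
    by apply/eqP; rewrite eqn_leq sge ltn_ord.
  have -> : val (s + 1) = 0%N.
    by rewrite /= modnDmr addn1 se modnn.
  rewrite big_ord0 se (_ : \sum_(i < _) g i = \sum_(j : F) g (val j)) //.
  rewrite -[LHS](tr [seq x - s | x <- s :: l]) /trace.
  apply: eq_bigr => j _; rewrite /g /translate -map_comp; congr d.
  by apply: eq_map => x /=; rewrite natr_Zp.
by rewrite big_ord_recr /= gs addrAC subrr add0r.
Qed.

(** The connecting maps for [g - 1] and for the norm, applied alternately to the constant 1 in
    dimension 0. The two components live in dimensions [2k] and [2k + 1], that is, on words of
    length [2k + 1] and [2k + 2]. *)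
Fixpoint tower_pair (k : nat) : (seq F -> F) * (seq F -> F) :=
  if k is k'.+1 then
    let e := coboundary (norm_primitive (tower_pair k').2) in
    (e, coboundary (diff_primitive e))
  else let e := fun l => (size l == 1)%:R in (e, coboundary (diff_primitive e)).

Definition even_tower k := (tower_pair k).1.
Definition odd_tower k := (tower_pair k).2.

Lemma odd_towerE k : odd_tower k = coboundary (diff_primitive (even_tower k)).
Proof. by case: k. Qed.

Lemma even_towerS k :
  even_tower k.+1 = coboundary (norm_primitive (odd_tower k)).
Proof. by []. Qed.

Lemma even_tower_nil k : even_tower k [::] = 0.
Proof. by case: k. Qed.

Lemma odd_tower_nil k : odd_tower k [::] = 0.
Proof. by rewrite odd_towerE. Qed.

Lemma coboundary_even_tower k l : coboundary (even_tower k) l = 0.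
Proof.
case: k => [|k]; last exact: coboundaryK.
case: l => [|x l] //=; rewrite /even_tower /=.
case: l => [|y l] /=; first by rewrite subr0.
case: l => [|z l] /=; first by rewrite subr0 subrr.
rewrite [X in _ - (_ - (_ - X))](_ : _ = 0) ?subrr //.
by elim: l => //= t l ->; rewrite subr0.
Qed.

(** Translation commutes with [coboundary], so translating by 1 changes [odd_tower k] by the
    coboundary of [even_tower k], which is zero. The trace condition is a hypothesis because its
    inductive proof uses this lemma. *)
Lemma odd_tower_invariant_of_trace k : (forall l, trace (even_tower k) l = 0) ->
  forall j l, translate j (odd_tower k) l = odd_tower k l.
Proof.
move=> tr j l; rewrite -(natr_Zp j); elim: (val j) => [|i IHi].
  by rewrite /translate map_add0.
rewrite -IHi -natr1 /translate.
have -> : [seq x + (i%:R + 1) | x <- l] = [seq x + 1 | x <- [seq x + i%:R | x <- l]].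
  by rewrite -map_comp; apply: eq_map => x /=; rewrite addrA.
move: [seq x + i%:R | x <- l] => t.
apply/eqP; rewrite -subr_eq0 odd_towerE -/(translate 1 (coboundary _) t).
rewrite -coboundary_translate -coboundaryB.
rewrite (eq_coboundary (diff_primitiveP tr (even_tower_nil k))).
by rewrite coboundary_even_tower.
Qed.

(** For [k = 0] the trace on a one-letter word is [r], zero in ['F_r]. Afterwards the trace is the
    coboundary of [odd_tower], itself a coboundary. *)
Lemma trace_even_tower k : forall l, trace (even_tower k) l = 0.
Proof.
elim: k => [|k IH] l.
  rewrite /trace /translate /even_tower /=.
  under eq_bigr do rewrite size_map.
  rewrite sumr_const (card_Fp r_prime).
  exact: mulrn_pchar (pchar_Fp r_prime) _.
rewrite /trace; under eq_bigr do rewrite even_towerS -coboundary_translate.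
rewrite -coboundary_sum -/(trace _).
rewrite (eq_coboundary (trace_norm_primitive (odd_tower_invariant_of_trace IH)
  (odd_tower_nil k))).
by rewrite odd_towerE coboundaryK.
Qed.

Lemma odd_tower_invariant k j l : translate j (odd_tower k) l = odd_tower k l.
Proof. exact/odd_tower_invariant_of_trace/trace_even_tower. Qed.

End Tower.

(** * Cubical grids *)

Section CubicalBoundary.
Variable V : comPzRingType.
Implicit Types (f g : seq nat -> V) (a : seq nat).

(* A cell of the grid is a list of coordinates: the even number [2 l] is the
   grid point [l] and the odd number [2 l + 1] is the edge from [l] to [l + 1]. *)
Fixpoint cube_boundary f a : V :=
  if a is x :: a' then
    (if odd x then f (x.+1 :: a') - f (x.-1 :: a') else 0)
      + (-1) ^+ odd x * cube_boundary (fun b => f (x :: b)) a'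
  else 0.

Fixpoint facets a : seq (seq nat) :=
  if a is x :: a' then
    (if odd x then [:: x.+1 :: a'; x.-1 :: a'] else [::])
      ++ [seq x :: b | b <- facets a']
  else [::].

Lemma eq_cube_boundary f g a : f =1 g -> cube_boundary f a = cube_boundary g a.
Proof.
elim: a f g => //= x a IH f g fg; rewrite !fg.
by congr (_ + _ * _); apply: IH => b.
Qed.

Lemma cube_boundaryB f g a :
  cube_boundary (fun b => f b - g b) a = cube_boundary f a - cube_boundary g a.
Proof.
by elim: a f g => [|x a IH] f g /=; [rewrite subr0 | rewrite IH; case: odd; ring].
Qed.

Lemma cube_boundaryD f g a :
  cube_boundary (fun b => f b + g b) a = cube_boundary f a + cube_boundary g a.
Proof.
by elim: a f g => [|x a IH] f g /=; [rewrite addr0 | rewrite IH; case: odd; ring].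
Qed.

Lemma cube_boundaryZ v f a :
  cube_boundary (fun b => v * f b) a = v * cube_boundary f a.
Proof.
by elim: a f => [|x a IH] f /=; [rewrite mulr0 | rewrite IH; case: odd; ring].
Qed.

Lemma cube_boundary_eq0 f a :
  (forall b, b \in facets a -> f b = 0) -> cube_boundary f a = 0.
Proof.
elim: a f => //= x a IH f f0; rewrite IH ?mulr0 ?addr0; last first.
  by move=> b ab; apply: f0; rewrite mem_cat map_f ?orbT.
case: ifP f0 => // _ f0.
by rewrite !f0 ?subrr // !inE eqxx ?orbT.
Qed.

Lemma cube_boundary_const v a : cube_boundary (fun=> v) a = 0.
Proof. by elim: a => //= x a ->; case: odd; rewrite ?subrr mulr0 add0r. Qed.

Lemma cube_boundaryK f a : cube_boundary (cube_boundary f) a = 0.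
Proof.
elim: a f => //= x a IH f; case: ifP => xodd; rewrite /= ?xodd /=; last first.
  rewrite add0r expr0 mul1r -[RHS](IH (fun b => f (x :: b))).
  by apply: eq_cube_boundary => b; rewrite add0r mul1r.
rewrite (_ : odd x.-1 = false) /=; last by case: x xodd {IH} => //= x /negbTE.
rewrite [X in _ + _ * X](eq_cube_boundary _ (g := fun b => f (x.+1 :: b) - f (x.-1 :: b)
    - cube_boundary (fun b => f (x :: b)) b)); last by move=> b; ring.
by rewrite !cube_boundaryB IH expr0 expr1; ring.
Qed.

(** Total in [i]: coordinates missing from [a] are read as 0. *)
Fixpoint insert i v a : seq nat :=
  if i is i'.+1 then head 0%N a :: insert i' v (behead a) else v :: a.

(** An even coordinate contributes neither a facet nor a sign, so the boundary commutes with the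
    inclusion of a grid hyperplane. *)
Lemma cube_boundary_insert f i v a : ~~ odd v ->
  cube_boundary f (insert i v a) = cube_boundary (fun b => f (insert i v b)) a.
Proof.
move=> vN; elim: i a f => [|i IH] [|x a] f //=; rewrite ?(negbTE vN) ?IH //=.
- by rewrite add0r expr0 mul1r.
- by rewrite add0r expr0 mul1r.
by rewrite mulr0 addr0.
Qed.

Fixpoint cube_sum (n k : nat) f : V :=
  if k is k'.+1 then \sum_(i < n) cube_sum n k' (fun a => f (i.*2.+1 :: a))
  else f [::].

Lemma cube_sumS n k f :
  cube_sum n k.+1 f = \sum_(i < n) cube_sum n k (fun a => f (i.*2.+1 :: a)).
Proof. by []. Qed.

Lemma eq_cube_sum n k f g :
  (forall a, size a = k -> all odd a -> f a = g a) ->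
  cube_sum n k f = cube_sum n k g.
Proof.
elim: k f g => [|k IH] f g fg /=; first exact: fg.
apply: eq_bigr => i _; apply: IH => a ak aodd.
by apply: fg; rewrite /= ?ak // odd_double.
Qed.

Lemma cube_sum0 n k : cube_sum n k (fun=> 0) = 0.
Proof. by elim: k => //= k IH; rewrite big1. Qed.

Lemma cube_sumB n k f g :
  cube_sum n k (fun b => f b - g b) = cube_sum n k f - cube_sum n k g.
Proof.
elim: k f g => //= k IH f g.
by under eq_bigr do rewrite IH; rewrite sumrB.
Qed.

Lemma cube_sumZ n k v f :
  cube_sum n k (fun b => v * f b) = v * cube_sum n k f.
Proof.
elim: k f => //= k IH f.
by under eq_bigr do rewrite IH; rewrite mulr_sumr.
Qed.

Lemma exchange_cube_sum (I : finType) n k (f : I -> seq nat -> V) :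
  cube_sum n k (fun b => \sum_i f i b) = \sum_i cube_sum n k (f i).
Proof.
elim: k f => //= k IH f.
under eq_bigr do rewrite IH.
exact: exchange_big.
Qed.

(** Stokes' formula on the grid: interior facets cancel by telescoping in each coordinate, leaving
    the two opposite sides of the cube. *)
Lemma cube_sum_boundary n k f :
  cube_sum n k.+1 (cube_boundary f) =
  \sum_(i < k.+1) (-1) ^+ i *
    (cube_sum n k (fun a => f (insert i n.*2 a))
     - cube_sum n k (fun a => f (insert i 0 a))).
Proof.
elim: k f => [|k IH] f.
  rewrite /= big_ord_recl big_ord0 expr0 mul1r addr0 /=.
  under eq_bigr do rewrite odd_double /= mulr0 addr0.
  elim: n => [|n IHn]; first by rewrite big_ord0 subrr.
  by rewrite big_ord_recr /= IHn doubleS; ring.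
rewrite big_ord_recl expr0 mul1r cube_sumS.
transitivity (\sum_(i < n) (cube_sum n k.+1 (fun a => f (i.*2.+2 :: a))
     - cube_sum n k.+1 (fun a => f (i.*2 :: a))
     - cube_sum n k.+1 (cube_boundary (fun b => f (i.*2.+1 :: b))))).
  apply: eq_bigr => i _; rewrite -!cube_sumB; apply: eq_cube_sum => a _ _.
  by rewrite [cube_boundary _ _]/= odd_double /= expr1 mulN1r.
rewrite sumrB; congr (_ + _).
  have H m : \sum_(i < m) (cube_sum n k.+1 (fun a => f (i.*2.+2 :: a)) -
     cube_sum n k.+1 (fun a => f (i.*2 :: a))) =
     cube_sum n k.+1 (fun a => f (m.*2 :: a)) - cube_sum n k.+1 (fun a => f (0%N :: a)).
    elim: m => [|m IHm]; first by rewrite big_ord0 subrr.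
    by rewrite big_ord_recr IHm doubleS [LHS]addrC; apply: subrKA.
  exact: H.
under eq_bigr do rewrite IH.
rewrite exchange_big -sumrN /=; apply: eq_bigr => i _.
by rewrite -mulr_sumr -mulNr exprS mulN1r sumrB.
Qed.

End CubicalBoundary.

(** * Evaluating cochains on subdivided cells *)

Section Evaluation.
Variables (F : zmodType) (V : comPzRingType).
Implicit Types (c d : seq F -> V) (L : seq nat -> F) (a b : seq nat).

(* The value of the cochain [c] on the barycentric subdivision of the cell [a],
   pushed forward along the labelling [L] of the cells. *)
Fixpoint cell_eval L (k : nat) c a : V :=
  if k is k'.+1 then
    cube_boundary (cell_eval L k' (fun l => c (rcons l (L a)))) a
  else c [:: L a].

Lemma cell_evalS L k c a :
  cell_eval L k.+1 c a = cube_boundary (cell_eval L k (fun l => c (rcons l (L a)))) a.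
Proof. by []. Qed.

Lemma eq_cell_eval L k c d a : (forall l, size l = k.+1 -> c l = d l) ->
  cell_eval L k c a = cell_eval L k d a.
Proof.
elim: k c d a => [|k IH] c d a cd /=; first exact: cd.
apply: eq_cube_boundary => b; apply: IH => l lk.
by apply: cd; rewrite size_rcons lk.
Qed.

Lemma eq_cell_eval_label L L' k c a : L =1 L' -> cell_eval L k c a = cell_eval L' k c a.
Proof.
move=> LL; elim: k c a => [|k IH] c a /=; first by rewrite LL.
by apply: eq_cube_boundary => b; rewrite IH LL.
Qed.

Lemma cell_evalB L k c d a :
  cell_eval L k (fun l => c l - d l) a = cell_eval L k c a - cell_eval L k d a.
Proof.
elim: k c d a => //= k IH c d a.
by rewrite -cube_boundaryB; apply: eq_cube_boundary => b; rewrite IH.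
Qed.

Lemma cell_evalD L k c d a :
  cell_eval L k (fun l => c l + d l) a = cell_eval L k c a + cell_eval L k d a.
Proof.
elim: k c d a => //= k IH c d a.
by rewrite -cube_boundaryD; apply: eq_cube_boundary => b; rewrite IH.
Qed.

Lemma cell_evalZ L k v c a : cell_eval L k (fun l => v * c l) a = v * cell_eval L k c a.
Proof.
elim: k c a => //= k IH c a.
by rewrite -cube_boundaryZ; apply: eq_cube_boundary => b; rewrite IH.
Qed.

Lemma cell_eval0 L k a : cell_eval L k (fun=> 0) a = 0.
Proof. by elim: k a => //= k IH a; apply: cube_boundary_eq0 => b _. Qed.

Lemma cell_eval_sum L k (I : finType) (c : I -> seq F -> V) a :
  cell_eval L k (fun l => \sum_i c i l) a = \sum_i cell_eval L k (c i) a.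
Proof.
elim: (index_enum I) => [|i s IH].
  rewrite big_nil -[RHS](cell_eval0 L k a); apply: eq_cell_eval => l _.
  by rewrite big_nil.
rewrite big_cons -IH -cell_evalD; apply: eq_cell_eval => l _.
by rewrite big_cons.
Qed.

Lemma cell_eval_translate L k j c a :
  cell_eval (fun b => L b + j) k c a = cell_eval L k (translate j c) a.
Proof.
elim: k c a => //= k IH c a.
apply: eq_cube_boundary => b; rewrite IH; apply: eq_cell_eval => l _.
by rewrite /translate map_rcons.
Qed.

Lemma cell_eval_insert L k c i v a : ~~ odd v ->
  cell_eval L k c (insert i v a) = cell_eval (fun b => L (insert i v b)) k c a.
Proof.
move=> vN; elim: k c a => //= k IH c a.
by rewrite cube_boundary_insert //; apply: eq_cube_boundary => b.
Qed.

(** Split the coboundary at the last letter. Deleting that letter gives the right-hand side; by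
    induction the other deletions give a boundary of a boundary. *)
Lemma cell_eval_coboundary L k c a :
  cell_eval L k.+1 (coboundary c) a = (-1) ^+ k.+1 * cube_boundary (cell_eval L k c) a.
Proof.
elim: k c a => [|k IH] c a.
  rewrite [LHS]/= (eq_cube_boundary _ (g := fun b => c [:: L a] - c [:: L b])).
    by rewrite cube_boundaryB cube_boundary_const; ring.
  by move=> b; rewrite subr0.
rewrite [LHS]/=.
have E b : cell_eval L k.+1 (fun l => coboundary c (rcons l (L a))) b =
  (-1) ^+ k.+1 * cube_boundary (cell_eval L k (fun l => c (rcons l (L a)))) b
  + (-1) ^+ k.+2 * cell_eval L k.+1 c b.
  rewrite -IH -cell_evalZ -cell_evalD; apply: eq_cell_eval => l lk.
  by rewrite coboundary_rcons lk.
rewrite (eq_cube_boundary _ E) cube_boundaryD !cube_boundaryZ cube_boundaryK.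
by rewrite mulr0 add0r.
Qed.

Lemma cell_eval_last_eq0 L k c a :
  (forall l, c (rcons l (L a)) = 0) -> cell_eval L k c a = 0.
Proof.
case: k => [|k] c0 /=; first exact: (c0 [::]).
by apply: cube_boundary_eq0 => b _; rewrite -[RHS](cell_eval0 L k b); apply: eq_cell_eval.
Qed.

Lemma cell_eval_repeat L k c a b : normalized c -> L b = L a ->
  cell_eval L k (fun l => c (rcons l (L a))) b = 0.
Proof.
move=> nc ba; apply: cell_eval_last_eq0 => l.
by rewrite ba -!cats1 -catA; exact: nc.
Qed.

(** Colours cannot increase when passing to a facet, and a flag of [k + 1] cells sees at most [k] of
    them. Two consecutive cells thus share a colour, hence a label, and [c] is normalized. *)
Lemma cell_eval_col_eq0 L (col : seq nat -> nat) k c a : normalized c ->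
  (forall a b, b \in facets a -> (col b <= col a)%N) ->
  (forall a b, b \in facets a -> col b = col a -> L b = L a) ->
  (col a < k)%N -> cell_eval L k c a = 0.
Proof.
move=> nc mono inj; elim: k c nc a => //= k IH c nc a ak.
apply: cube_boundary_eq0 => b ab.
have [ba|ba] := eqVneq (col b) (col a); first by apply: cell_eval_repeat => //; exact: inj.
apply: IH; first exact: normalized_rcons.
have := mono _ _ ab; move: ba ak; lia.
Qed.

Lemma count_odd_facet a b : b \in facets a -> (count odd b).+1 = count odd a.
Proof.
elim: a b => //= x a IH b; rewrite mem_cat => /orP[|/mapP[b' ab' ->{b}]].
  case: ifP => // xodd; rewrite !inE => /orP[] /eqP -> /=; first by rewrite xodd.
  by case: x xodd => //= x /negbTE ->.
by rewrite /= -(IH _ ab') addnS.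
Qed.

Lemma size_facet a b : b \in facets a -> size b = size a.
Proof.
elim: a b => //= x a IH b; rewrite mem_cat => /orP[|/mapP[b' ab' ->{b}]].
  by case: ifP => // _; rewrite !inE => /orP[] /eqP ->.
by rewrite /= (IH _ ab').
Qed.

Lemma facet_insert i x a b : (i <= size a)%N -> b \in facets (insert i x a) ->
  (exists y, b = insert i y a) \/ (exists2 b', b' \in facets a & b = insert i x b').
Proof.
elim: i a b => [|i IH] [|z a] b //=; rewrite ?cats0 ?mem_cat => ia.
- by case: ifP => // _; rewrite !inE => /orP[] /eqP ->; left; eexists.
- case/orP; first by case: ifP => // _; rewrite !inE => /orP[] /eqP ->; left; eexists.
  by move=> /mapP[b' ab' ->]; right; exists b'.
case/orP.
  case: ifP => // zodd; rewrite !inE => /orP[] /eqP ->; right.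
    by exists (z.+1 :: a); rewrite //= inE eqxx.
  by exists (z.-1 :: a); rewrite //= !inE eqxx orbT.
case/mapP=> b' /(IH _ _ ia)[[y ->]|[b'' ab'' ->]] ->; first by left; exists y.
by right; exists (z :: b''); rewrite //= mem_cat map_f ?orbT.
Qed.

(** A flag takes [k + 1] passages to a facet, of which at most [k] can lower the dimension of [a].
    One passage therefore changes coordinate [i], and it repeats a label. *)
Lemma cell_eval_degenerate L i x k c a : normalized c ->
  (forall y b, L (insert i y b) = L (insert i x b)) ->
  (i <= size a)%N -> count odd a = k -> cell_eval L k.+1 c (insert i x a) = 0.
Proof.
move=> nc Li; elim: k c nc a => [|k IH] c nc a ia ak;
  rewrite cell_evalS; apply: cube_boundary_eq0 => b /(facet_insert ia)[[y ->]|[b' ab' ->]].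
- by apply: cell_eval_repeat => //; exact: Li.
- by move: (count_odd_facet ab'); rewrite ak.
- by apply: cell_eval_repeat => //; exact: Li.
apply: IH; first exact: normalized_rcons.
  by rewrite (size_facet ab').
by apply/eqP; rewrite -eqSS (count_odd_facet ab') ak.
Qed.

End Evaluation.

(** * Labels of cells from labels of vertices *)

Section TopLabel.
Variable F : zmodType.
Implicit Types (s : seq (nat * F)) (x y : nat * F).

(** Giving a cell the label of highest colour among its vertices makes colours monotone along flags,
    as [cell_eval_col_eq0] requires. *)
Definition top_label s : nat * F :=
  foldr (fun x y => if (y.1 <= x.1)%N then x else y) (head (0%N, 0) s) s.

Lemma top_label_in s : s != [::] -> top_label s \in s.
Proof.
case: s => // x s _; rewrite /top_label /=.
suff H z t : foldr (fun x y : nat * F => if (y.1 <= x.1)%N then x else y) z t \in z :: t.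
  by case: ifP => _; [rewrite mem_head | exact: H].
elim: t => [|y t IH] /=; first exact: mem_head.
case: ifP => _; rewrite !inE ?eqxx ?orbT //.
by move: IH; rewrite inE => /orP[] ->; rewrite ?orbT.
Qed.

Lemma top_label_max s x : x \in s -> (x.1 <= (top_label s).1)%N.
Proof.
rewrite /top_label; move: (head _ s) => z.
elim: s => //= y s IH; rewrite inE => /predU1P[->|/IH xs].
  by case: ifP => // /negbT; rewrite -ltnNge => /ltnW.
by case: ifP => // /(leq_trans xs).
Qed.

Lemma top_label_translate s j : s != [::] ->
  top_label [seq (x.1, x.2 + j) | x <- s] =
  ((top_label s).1, (top_label s).2 + j).
Proof.
case: s => // x s _; rewrite /top_label [head _ _]/= [head _ (x :: s)]/=.
have H z t : foldr (fun x y : nat * F => if (y.1 <= x.1)%N then x else y)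
     (z.1, z.2 + j) [seq (x.1, x.2 + j) | x <- t] =
   let w := foldr (fun x y : nat * F => if (y.1 <= x.1)%N then x else y) z t in
   (w.1, w.2 + j).
  by elim: t => //= y t -> /=; case: ifP.
exact: (H x (x :: s)).
Qed.

Definition consistent s := {in s &, forall x y, x.1 = y.1 -> x = y}.

Lemma top_label_sub s1 s2 : consistent s2 -> s1 != [::] ->
  {subset s1 <= s2} ->
  ((top_label s1).1 <= (top_label s2).1)%N /\
  ((top_label s1).1 = (top_label s2).1 -> top_label s1 = top_label s2).
Proof.
move=> cs s10 sub.
have t1 : top_label s1 \in s2 by apply/sub/top_label_in.
split=> [|e]; first exact: top_label_max.
apply: cs => //; apply: top_label_in.
by apply: contraNneq s10 => s2e; move: t1; rewrite s2e.
Qed.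

End TopLabel.

Fixpoint cell_vertices (a : seq nat) : seq (seq nat) :=
  if a is x :: a' then
    if odd x then
      [seq x.+1 :: v | v <- cell_vertices a'] ++ [seq x.-1 :: v | v <- cell_vertices a']
    else [seq x :: v | v <- cell_vertices a']
  else [:: [::]].

Lemma cell_vertices_neq0 a : cell_vertices a != [::].
Proof.
by elim: a => //= x a; case: (cell_vertices a) => // v s _; case: ifP.
Qed.

Lemma cell_vertices_facet a b :
  b \in facets a -> {subset cell_vertices b <= cell_vertices a}.
Proof.
elim: a b => //= x a IH b; rewrite mem_cat => /orP[|/mapP[b' /IH ab' ->{b}] v].
  case: ifP => // xodd; rewrite !inE => /orP[] /eqP -> v /=; rewrite ?xodd /=.
    by rewrite mem_cat => ->.
  rewrite (_ : odd x.-1 = false); last by case: x xodd => //= x /negbTE.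
  by rewrite mem_cat => ->; rewrite orbT.
rewrite /=; case: ifP => _; rewrite ?mem_cat.
  by case/orP=> /mapP[w /ab' aw ->]; rewrite map_f ?orbT.
by move=> /mapP[w /ab' aw ->]; rewrite map_f.
Qed.

Lemma cell_vertices_insert i v a : ~~ odd v ->
  cell_vertices (insert i v a) = [seq insert i v b | b <- cell_vertices a].
Proof.
move=> vN; elim: i a => [|i IH] a /=; first by rewrite (negbTE vN).
case: a => [|x a] /=; rewrite IH; first by rewrite -map_comp.
by case: ifP => _; rewrite ?map_cat -!map_comp.
Qed.

Lemma mem_cell_vertices_insert i x a v : v \in cell_vertices (insert i x a) ->
  exists2 b, b \in cell_vertices a & exists y, v = insert i y b.
Proof.
elim: i a v => [|i IH] a v /=.
  case: ifP => _; rewrite ?mem_cat; last by move=> /mapP[b ab ->]; exists b => //; exists x.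
  by case/orP=> /mapP[b ab ->]; exists b => //; eexists.
case: a => [|z a] /=.
  by move=> /mapP[b /IH[b' ab' [y ->]] ->]; exists b' => //; exists y; case: b' ab'.
case: ifP => _; rewrite ?mem_cat.
  case/orP=> /mapP[b /IH[b' ab' [y ->]] ->].
    by exists (z.+1 :: b'); [rewrite mem_cat map_f | exists y].
  by exists (z.-1 :: b'); [rewrite mem_cat map_f ?orbT | exists y].
by move=> /mapP[b /IH[b' ab' [y ->]] ->]; exists (z :: b'); [rewrite map_f|exists y].
Qed.

Lemma cell_vertices_insert_exists i x a b : b \in cell_vertices a ->
  exists y, insert i y b \in cell_vertices (insert i x a).
Proof.
elim: i a b => [|i IH] a b ab /=.
  case: ifP => _; last by exists x; rewrite map_f.
  by exists x.+1; rewrite mem_cat map_f.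
case: a ab => [|z a] /=.
  rewrite inE => /eqP -> /=; have [//|y yP] := IH [::] [::].
  by exists y; rewrite map_f.
case: ifP => _; rewrite ?mem_cat.
  by case/orP=> /mapP[b' /IH[y yP] -> /=]; exists y; rewrite mem_cat map_f ?orbT.
by move=> /mapP[b' /IH[y yP] -> /=]; exists y; rewrite map_f.
Qed.

(** * Integrals of cochains over labelled cubes *)

Section Integral.
Variables (F : zmodType) (V : comPzRingType) (X : Type) (lab : X -> nat * F) (n : nat).
Implicit Types (Q : seq nat -> X) (c : seq F -> V).

Definition cell_label Q a := top_label [seq lab (Q v) | v <- cell_vertices a].

Definition consistent_on Q :=
  forall a, consistent [seq lab (Q v) | v <- cell_vertices a].

Definition integral Q k c : V :=
  cube_sum n k (cell_eval (fun a => (cell_label Q a).2) k c).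

Lemma cell_labels_neq0 Q a : [seq lab (Q v) | v <- cell_vertices a] != [::].
Proof. by have := cell_vertices_neq0 a; case: cell_vertices. Qed.

Lemma eq_integral Q Q' k c : Q =1 Q' -> integral Q k c = integral Q' k c.
Proof.
move=> QQ; apply: eq_cube_sum => a _ _; apply: eq_cell_eval_label => b.
rewrite /cell_label; do 2 f_equal; apply: eq_map => v.
by rewrite QQ.
Qed.

Lemma eq_integral_cochain Q k c d : c =1 d -> integral Q k c = integral Q k d.
Proof. by move=> cd; apply: eq_cube_sum => a _ _; apply: eq_cell_eval => l _. Qed.

Lemma integralB Q k c d :
  integral Q k (fun l => c l - d l) = integral Q k c - integral Q k d.
Proof.
by rewrite /integral -cube_sumB; apply: eq_cube_sum => a _ _; rewrite cell_evalB.
Qed.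

Lemma integral_sum (I : finType) Q k (c : I -> seq F -> V) :
  integral Q k (fun l => \sum_i c i l) = \sum_i integral Q k (c i).
Proof.
rewrite /integral -exchange_cube_sum.
by apply: eq_cube_sum => a _ _; rewrite cell_eval_sum.
Qed.

Lemma integral_translate Q Q' j k c :
  (forall a, lab (Q' a) = ((lab (Q a)).1, (lab (Q a)).2 + j)) ->
  integral Q' k c = integral Q k (translate j c).
Proof.
move=> QQ'; apply: eq_cube_sum => a _ _; rewrite -cell_eval_translate.
apply: eq_cell_eval_label => b; rewrite /cell_label.
have -> : [seq lab (Q' v) | v <- cell_vertices b] =
    [seq (x.1, x.2 + j) | x <- [seq lab (Q v) | v <- cell_vertices b]].
  by rewrite -map_comp; apply: eq_map => v /=.
by rewrite top_label_translate // cell_labels_neq0.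
Qed.

Lemma consistent_on_insert Q i v : ~~ odd v -> consistent_on Q ->
  consistent_on (fun a => Q (insert i v a)).
Proof.
move=> vN cQ a; have := cQ (insert i v a).
by rewrite cell_vertices_insert // -map_comp.
Qed.

Lemma integral_insert Q k c i v : ~~ odd v ->
  cube_sum n k (fun a => cell_eval (fun b => (cell_label Q b).2) k c (insert i v a)) =
  integral (fun a => Q (insert i v a)) k c.
Proof.
move=> vN; apply: eq_cube_sum => a _ _; rewrite cell_eval_insert //.
apply: eq_cell_eval_label => b.
by rewrite /cell_label cell_vertices_insert // -map_comp.
Qed.

Lemma integral_coboundary Q k c :
  integral Q k.+1 (coboundary c) = (-1) ^+ k.+1 *
  \sum_(i < k.+1) (-1) ^+ i * (integral (fun a => Q (insert i n.*2 a)) k c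
                               - integral (fun a => Q (insert i 0 a)) k c).
Proof.
rewrite /integral.
under eq_cube_sum do rewrite cell_eval_coboundary.
rewrite cube_sumZ cube_sum_boundary; congr (_ * _); apply: eq_bigr => i _.
by rewrite !integral_insert ?odd_double.
Qed.

(** A cube constant in one direction has cell labels constant in that direction, so every top cell
    is degenerate. *)
Lemma integral_degenerate Q k i c : consistent_on Q -> normalized c ->
  (i <= k)%N -> (forall y b, Q (insert i y b) = Q (insert i 0 b)) ->
  integral Q k.+1 c = 0.
Proof.
move=> cQ nc ik Qi; rewrite -(cube_sum0 V n k.+1).
apply: eq_cube_sum => a ak aodd.
have -> : a = insert i (nth 0%N a i) (take i a ++ drop i.+1 a).
  have : (i < size a)%N by rewrite ak.
  elim: i a {ik Qi ak aodd} => [|i IH] [|x a] //= ia; first by rewrite drop0.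
  by rewrite -IH.
have sz : size (take i a ++ drop i.+1 a) = k.
  by rewrite size_cat size_drop size_take ak; case: ltnP; lia.
apply: cell_eval_degenerate => //; last first.
- rewrite -sz; apply/eqP; rewrite -all_count.
  move: aodd; rewrite -{1}(cat_take_drop i a) !all_cat => /andP[->] /=.
  by rewrite -addn1 addnC -drop_drop; case: (drop i a) => //= x s /andP[_]; rewrite drop0.
- by rewrite sz.
(* The two cells carry the same set of vertex labels, possibly listed differently; consistency makes
   their top labels agree. *)
suff H x y b (z := nth 0%N a i) : {subset [seq lab (Q v) | v <- cell_vertices (insert i x b)] <=
     [seq lab (Q v) | v <- cell_vertices (insert i y b)]}.
  move=> y b; congr (_.2).
  have [le1 e1] := top_label_sub (cQ _) (cell_labels_neq0 Q _) (H y (nth 0%N a i) b).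
  have [le2 _] := top_label_sub (cQ _) (cell_labels_neq0 Q _) (H (nth 0%N a i) y b).
  by apply: e1; apply/eqP; rewrite eqn_leq le1 le2.
move=> l /mapP[v /mem_cell_vertices_insert[w wb [t ->]] ->].
have [t' t'P] := cell_vertices_insert_exists i y wb.
by apply/mapP; exists (insert i t' w) => //; rewrite !(Qi _ w).
Qed.

Lemma integral_few_colours Q k c : consistent_on Q -> normalized c ->
  (forall a, (lab (Q a)).1 < k)%N -> integral Q k c = 0.
Proof.
move=> cQ nc Qk; rewrite -(cube_sum0 V n k).
apply: eq_cube_sum => a _ _.
apply: (cell_eval_col_eq0 (col := fun a => (cell_label Q a).1)) => //.
- move=> {}a b /cell_vertices_facet ab.
  apply: (top_label_sub (cQ _) (cell_labels_neq0 Q b) _).1 => l /mapP[v /ab av ->].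
  exact: map_f.
- move=> {}a b /cell_vertices_facet ab e; congr (_.2).
  apply: (top_label_sub (cQ _) (cell_labels_neq0 Q b) _).2 => // l /mapP[v /ab av ->].
  exact: map_f.
rewrite /cell_label.
by have /mapP[v _ ->] := top_label_in (cell_labels_neq0 Q a).
Qed.

End Integral.

(** * Joins of arcs and the equivariant labelling theorem *)

Section IteratedSum.
Variables (F : finZmodType) (V : zmodType).
Implicit Types (G : seq F -> V) (js : seq F).

Fixpoint sum_lists (k : nat) G : V :=
  if k is k'.+1 then \sum_(j : F) sum_lists k' (fun js => G (j :: js)) else G [::].

Lemma sum_listsS k G :
  sum_lists k.+1 G = \sum_(j : F) sum_lists k (fun js => G (j :: js)).
Proof. by []. Qed.

Lemma eq_sum_lists k G G' : (forall js, size js = k -> G js = G' js) ->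
  sum_lists k G = sum_lists k G'.
Proof.
elim: k G G' => [|k IH] G G' GG /=; first exact: GG.
by apply: eq_bigr => j _; apply: IH => js jk; apply: GG; rewrite /= jk.
Qed.

Lemma sum_lists0 k : sum_lists k (fun=> 0) = 0.
Proof. by elim: k => //= k IH; rewrite big1. Qed.

Lemma sum_listsB k G G' :
  sum_lists k (fun js => G js - G' js) = sum_lists k G - sum_lists k G'.
Proof. by elim: k G G' => //= k IH G G'; rewrite -sumrB; apply: eq_bigr => j _. Qed.

Lemma exchange_sum_lists (I : finType) k (G : I -> seq F -> V) :
  sum_lists k (fun js => \sum_i G i js) = \sum_i sum_lists k (G i).
Proof.
elim: k G => //= k IH G; under eq_bigr do rewrite IH.
exact: exchange_big.
Qed.

Lemma sum_lists_map j k G :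
  sum_lists k (fun js => G [seq x + j | x <- js]) = sum_lists k G.
Proof.
elim: k G => //= k IH G; rewrite [RHS](reindex_inj (addIr j)) /=.
by apply: eq_bigr => i _; exact: (IH (fun js => G (i + j :: js))).
Qed.

End IteratedSum.

(** Moves the [q]-th factor of a join to the next arc of its circle. *)
Fixpoint increment (F : nzRingType) (q : nat) (js : seq F) : seq F :=
  if q is q'.+1 then head 0 js :: increment q' (behead js)
  else head 0 js + 1 :: behead js.

Lemma sum_lists_increment (F : finNzRingType) (V : zmodType) q k
    (G : seq F -> V) : (q < k)%N ->
  sum_lists k (fun js => G (increment q js)) = sum_lists k G.
Proof.
elim: q k G => [|q IH] [|k] G //= qk; last by apply: eq_bigr => j _; apply: (IH _ (fun js => G (j :: js))).
by rewrite [RHS](reindex_inj (addIr 1)).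
Qed.

Section Joins.
Variables (r : nat) (X : Type) (n : nat).
Hypothesis r_prime : prime r.
Local Notation F := 'F_r.
Variables (join : nat -> X -> X -> X) (arc : nat -> F -> nat -> X).
Hypothesis join_left : forall x y, join 0 x y = x.
Hypothesis join_right : forall x y, join n.*2 x y = y.
Hypothesis arc_end : forall k j, arc k j n.*2 = arc k (j + 1) 0.
Implicit Types (c : seq F -> F) (js : seq F) (a b : seq nat).

(* The coordinates of the iterated join of [k + 1] arcs are listed from the
   outermost arc inwards as [u_k; t_k; u_(k-1); ...; t_1; u_0], where [u_i] is the
   position on the [i]-th arc and [t_i] is the join parameter. *)
Fixpoint join_cube k js a : X :=
  if k is k'.+1 then
    join (nth 0%N a 1) (join_cube k' (behead js) (drop 2 a))
      (arc k (head 0 js) (head 0%N a))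
  else arc 0 (head 0 js) (head 0%N a).

Lemma join_cubeS k js x y a : join_cube k.+1 js [:: x, y & a] =
  join y (join_cube k (behead js) a) (arc k.+1 (head 0 js) x).
Proof. by rewrite /= drop0. Qed.

Lemma insertSS i b : exists x y b', forall w, insert i.+2 w b = [:: x, y & insert i w b'].
Proof. by do 3 eexists. Qed.

Lemma insertSS_cons i v x y b : insert i.+2 v [:: x, y & b] = [:: x, y & insert i v b].
Proof. by []. Qed.

Lemma join_cube_arc q k js a : (q <= k)%N ->
  join_cube k js (insert q.*2 n.*2 a) = join_cube k (increment q js) (insert q.*2 0 a).
Proof.
elim: q k js a => [|q IH] [|k] js a // qk; try by rewrite /= arc_end.
have [x [y [b E]]] := insertSS q.*2 a.
by rewrite doubleS !E !join_cubeS IH.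
Qed.

(** At this end of a join parameter only the arc remains, so the coordinate just after the
    parameter, which belongs to the inner join, is idle. *)
Lemma join_cube_right q k js y b : (q < k)%N ->
  join_cube k js (insert q.*2.+1 n.*2 (insert q.*2.+1 y b)) =
  join_cube k js (insert q.*2.+1 n.*2 (insert q.*2.+1 0 b)).
Proof.
elim: q k js b => [|q IH] [|k] js b // qk; first by rewrite /= !join_right.
have [x [z [b' E]]] := insertSS q.*2.+1 b.
by rewrite doubleS !E !insertSS_cons !join_cubeS IH.
Qed.

(** At this end only the inner join remains, so the position on the outer arc, just before the
    parameter, is idle. *)
Lemma join_cube_left q k js y b : (q < k)%N ->
  join_cube k js (insert q.*2.+1 0 (insert q.*2 y b)) =
  join_cube k js (insert q.*2.+1 0 (insert q.*2 0 b)).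
Proof.
elim: q k js b => [|q IH] [|k] js b // qk; first by rewrite /= !join_left.
have [x [z [b' E]]] := insertSS q.*2 b.
by rewrite doubleS !E !insertSS_cons !join_cubeS IH.
Qed.

Variables (lab : X -> nat * F) (K : nat).
Hypothesis lab_equivariant : forall k js j a, (k <= K)%N ->
  size js = k.+1 -> lab (join_cube k [seq x + j | x <- js] a) =
  ((lab (join_cube k js a)).1, (lab (join_cube k js a)).2 + j).
Hypothesis lab_consistent : forall k js, (k <= K)%N -> size js = k.+1 ->
  consistent_on lab (join_cube k js).

(** Evaluation on a cell generating the chains of dimension [2k + 1] over F_r[Z_r]: the sphere
    joined from [k] full circles, joined further with arc [0] of the last circle. *)
Definition odd_chain k c : F := sum_lists k (fun js =>
  integral lab n (join_cube k (0 :: js)) k.*2.+1 c).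

(** The same with the starting point of arc [0] in place of the arc: a generating cell of dimension
    [2k]. *)
Definition even_chain k c : F := sum_lists k (fun js =>
  integral lab n (fun a => join_cube k (0 :: js) (0%N :: a)) k.*2 c).

Lemma eq_even_chain k c d : c =1 d -> even_chain k c = even_chain k d.
Proof. by move=> cd; apply: eq_sum_lists => js _; apply: eq_integral_cochain. Qed.

Lemma even_chainB k c d :
  even_chain k (fun l => c l - d l) = even_chain k c - even_chain k d.
Proof.
by rewrite -sum_listsB; apply: eq_sum_lists => js _; rewrite integralB.
Qed.

Lemma odd_chain_sum (I : finType) k (c : I -> seq F -> F) :
  odd_chain k (fun l => \sum_i c i l) = \sum_i odd_chain k (c i).
Proof.
by rewrite -exchange_sum_lists; apply: eq_sum_lists => js _; rewrite integral_sum.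
Qed.

Lemma sum_integral_coboundary (Q : seq F -> seq nat -> X) p k c :
  sum_lists p (fun js => integral lab n (Q js) k.+1 (coboundary c)) =
  (-1) ^+ k.+1 * \sum_(i < k.+1) (-1) ^+ i *
    (sum_lists p (fun js => integral lab n (fun a => Q js (insert i n.*2 a)) k c)
     - sum_lists p (fun js => integral lab n (fun a => Q js (insert i 0 a)) k c)).
Proof.
under eq_sum_lists => js _ do rewrite integral_coboundary.
have sumZ v (G : seq F -> F) : sum_lists p (fun js => v * G js) = v * sum_lists p G.
  by elim: p G => //= p IH G; rewrite mulr_sumr; apply: eq_bigr.
rewrite sumZ exchange_sum_lists; congr (_ * _); apply: eq_bigr => i _.
by rewrite sumZ sum_listsB.
Qed.

Lemma sum_lists_eq0 p (G : seq F -> F) :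
  (forall js, size js = p -> G js = 0) -> sum_lists p G = 0.
Proof. by move=> G0; rewrite -[RHS](sum_lists0 F F p); apply: eq_sum_lists. Qed.

Lemma consistent_face i v k js : ~~ odd v -> (k <= K)%N -> size js = k.+1 ->
  consistent_on lab (fun a => join_cube k js (insert i v a)).
Proof. by move=> vN kK sjs; apply: consistent_on_insert => //; exact: lab_consistent. Qed.

(** The boundary of the cell of dimension [2k + 1] is [g - 1] applied to the cell of dimension [2k];
    the sign is that of [cell_eval_coboundary]. *)
Lemma odd_chain_coboundary k c : (k <= K)%N -> normalized c ->
  odd_chain k (coboundary c) = - (even_chain k (translate 1 c) - even_chain k c).
Proof.
move=> kK nc; rewrite /odd_chain sum_integral_coboundary big_ord_recl expr0 mul1r.
rewrite big1 ?addr0 => [|[i ik] _].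
  (* The sides in the outermost position: arc [0] ends where arc [1] starts, which equivariance
     turns into translation by 1, the sum over [js] absorbing the shift of the inner arcs. *)
  rewrite exprS mulN1r -signr_odd odd_double expr0 mulN1r; congr (- (_ - _)).
  rewrite -(sum_lists_map 1); apply: eq_sum_lists => js sjs.
  apply: integral_translate => a /=.
  rewrite -lab_equivariant //=; last by rewrite sjs.
  rewrite -[n.*2 :: a]/(insert 0.*2 n.*2 a).
  by rewrite join_cube_arc //= add0r.
rewrite lift0 -[nat_of_ord (Ordinal ik)]/i; apply/eqP; rewrite mulf_eq0; apply/orP; right.
rewrite subr_eq0; apply/eqP.
(* Odd coordinates are join parameters, whose two sides are degenerate. Positive even ones are
   positions on inner arcs, whose two sides have the same sum over [js] because the arcs of a circle
   close up. *)
have [q [iq|iq]] : exists q, i.+1 = q.*2.+1 \/ i.+1 = q.+1.*2.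
- by exists i./2; lia.
- rewrite iq !sum_lists_eq0 // => js sjs;
    (have -> : k.*2 = k.*2.-1.+1 by lia).
  + apply: (@integral_degenerate _ _ _ _ _ _ _ q.*2) => //; last by move=> y b; apply: join_cube_left; lia.
      by apply: (consistent_face (v := 0%N)) => //=; rewrite sjs.
    by lia.
  apply: (@integral_degenerate _ _ _ _ _ _ _ q.*2.+1) => //; last by move=> y b; apply: join_cube_right; lia.
    by apply: consistent_face => //=; rewrite ?sjs ?odd_double.
  by lia.
rewrite iq -[RHS](sum_lists_increment (q := q)); last by lia.
apply: eq_sum_lists => js sjs; apply: eq_integral => a.
by rewrite join_cube_arc //; lia.
Qed.

(** The first free coordinate is now the outermost join parameter. One of its ends collapses to a
    point; the other is the whole inner sphere, the sum of the translates of the cell of dimension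
    [2k + 1]. *)
Lemma even_chain_coboundary k c : (k.+1 <= K)%N -> normalized c ->
  even_chain k.+1 (coboundary c) = - odd_chain k (trace c).
Proof.
move=> kK nc; rewrite /even_chain doubleS sum_integral_coboundary big_ord_recl expr0 mul1r.
rewrite -[_ + _ in LHS]addrC big1 ?add0r => [|[i ik] _].
  rewrite (_ : (-1) ^+ k.*2.+2 = 1) ?mul1r; last by rewrite -signr_odd /= negbK odd_double.
  rewrite sum_lists_eq0 ?sub0r => [|js sjs]; last first.
    apply: (@integral_degenerate _ _ _ _ _ _ _ 0%N) => //.
      by apply: (consistent_on_insert (i := 0) (v := n.*2)
        (Q := fun a => join_cube k.+1 (0 :: js) (insert 0 0 a)));
        rewrite ?odd_double //; apply: consistent_face => //=; rewrite sjs.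
    by move=> y b; apply: (@join_cube_right 0 k.+1 _ _ (0%N :: b)).
  congr (- _); rewrite /trace odd_chain_sum sum_listsS; apply: eq_bigr => j _.
  rewrite -(sum_lists_map j) /odd_chain; apply: eq_sum_lists => js sjs.
  apply: integral_translate => a /=; rewrite join_left drop0.
  rewrite -lab_equivariant /= ?add0r ?sjs //; exact: ltnW.
rewrite lift0 -[nat_of_ord (Ordinal ik)]/i; apply/eqP; rewrite mulf_eq0; apply/orP; right.
rewrite subr_eq0; apply/eqP.
have cons js v v' : size js = k.+1 -> ~~ odd v -> 
    consistent_on lab (fun a => join_cube k.+1 (0 :: js) (0%N :: insert v' v a)).
  move=> sjs vN; apply: (consistent_on_insert (Q := fun a => join_cube k.+1 (0 :: js) (insert 0 0 a))) => //.
  by apply: consistent_face => //=; rewrite sjs.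
(* The outermost position being fixed, indices are shifted by one and the join parameters correspond
   to odd [i]. *)
have [q [iq|iq]] : exists q, i = q.*2.+1 \/ i = q.*2.
- by exists i./2; lia.
- rewrite iq !sum_lists_eq0 // => js sjs.
  + apply: (@integral_degenerate _ _ _ _ _ _ _ q.*2.+1) => //; first exact: (cons _ 0%N q.*2.+2).
      by lia.
    by move=> y b; apply: (@join_cube_left q.+1 k.+1 _ _ (0%N :: b)); lia.
  apply: (@integral_degenerate _ _ _ _ _ _ _ q.*2.+2) => //.
  + by apply: (cons _ _ q.*2.+2); rewrite ?odd_double.
  + by lia.
  by move=> y b; apply: (@join_cube_right q.+1 k.+1 _ _ (0%N :: b)); lia.
rewrite iq -[RHS](sum_lists_increment (q := q)); last by lia.
apply: eq_sum_lists => js sjs; apply: eq_integral => a.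
by apply: (@join_cube_arc q.+1 k.+1 _ (0%N :: a)); lia.
Qed.

Lemma normalized_norm_primitive c : normalized c -> normalized (@norm_primitive r c).
Proof. by move=> nc a x b; rewrite /norm_primitive nc mulr0. Qed.

Lemma normalized_diff_primitive c : normalized c -> normalized (@diff_primitive r c).
Proof.
move=> nc a x b; rewrite /diff_primitive big1 // => i _.
by rewrite map_cat /= nc.
Qed.

Lemma normalized_even_tower k : normalized (@even_tower r k).
Proof.
elim: k => [|k IH]; first by move=> [|y a] x b //=; rewrite /even_tower /= size_cat /= addnS.
rewrite even_towerS odd_towerE; apply/normalized_coboundary/normalized_norm_primitive.
exact/normalized_coboundary/normalized_diff_primitive.
Qed.

Lemma normalized_odd_tower k : normalized (@odd_tower r k).
Proof.
rewrite odd_towerE; apply/normalized_coboundary/normalized_diff_primitive.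
exact: normalized_even_tower.
Qed.

Lemma odd_chain_odd_tower k : (k <= K)%N ->
  odd_chain k (@odd_tower r k) = - even_chain k (@even_tower r k).
Proof.
move=> kK; rewrite odd_towerE odd_chain_coboundary //; last first.
  exact/normalized_diff_primitive/normalized_even_tower.
rewrite -even_chainB; congr (- _); apply: eq_even_chain => l.
by rewrite diff_primitiveP //; [exact: trace_even_tower | exact: even_tower_nil].
Qed.

(** Each pair of steps down the tower matches a pair of boundary formulas, and their signs cancel;
    at the bottom the constant 1 is evaluated at a point. *)
Lemma even_chain_even_tower k : (k <= K)%N -> even_chain k (@even_tower r k) = 1.
Proof.
elim: k => [_|k IH kK]; first by [].
rewrite even_towerS even_chain_coboundary //; last first.
  exact/normalized_norm_primitive/normalized_odd_tower.
have -> : odd_chain k (trace (norm_primitive (@odd_tower r k))) = odd_chain k (@odd_tower r k).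
  apply: eq_sum_lists => js _; apply: eq_integral_cochain => l.
  rewrite trace_norm_primitive //; first exact: odd_tower_invariant.
  exact: odd_tower_nil.
by rewrite odd_chain_odd_tower ?opprK ?IH //; exact: ltnW.
Qed.

(** The parity of [N] selects the chain of dimension exactly [N]. Its value on the tower is 1 or -1,
    yet [N] colours are too few for a nonzero integral. *)
Theorem equivariant_labelling_colours N : K = N./2 ->
  ~ (forall k js a, (k <= K)%N -> size js = k.+1 -> (lab (join_cube k js a)).1 < N)%N.
Proof.
move=> KN labN.
have one0 : (1 : F) != 0 by exact: oner_neq0.
have := odd_double_half N; case: (boolP (odd N)) => oN.
  rewrite add1n -KN => NK.
  have := odd_chain_odd_tower (leqnn K); rewrite even_chain_even_tower //.
  rewrite /odd_chain sum_lists_eq0 => [/esym/eqP|js sjs]; first by rewrite oppr_eq0 (negbTE one0).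
  apply: integral_few_colours; first by apply: lab_consistent => //=; rewrite sjs.
    exact: normalized_odd_tower.
  by move=> a; rewrite NK labN //= sjs.
rewrite add0n -KN => NK.
have := even_chain_even_tower (leqnn K).
rewrite /even_chain sum_lists_eq0 => [/esym/eqP|js sjs]; first by rewrite (negbTE one0).
apply: integral_few_colours; last by move=> a; rewrite NK labN //= sjs.
  by apply: (consistent_face (i := 0%N) (v := 0%N)) => //=; rewrite sjs.
exact: normalized_even_tower.
Qed.

End Joins.

(** * Labels from gaps *)

Section GapLabel.
Variables (R : realType) (r d : nat) (delta : R).
Hypotheses (r_prime : prime r) (delta_gt0 : 0 < delta).
Local Notation F := 'F_r.
Implicit Types (y z : F -> 'I_d -> R) (p : 'I_d * 'I_r.-1) (A B : {set F}).

(** As [p.2 < r - 1], the set has between 1 and [r - 1] elements, and there are [d * (r - 1)]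
    possible [p], one per colour. *)
Definition gap_set y p A : bool := (#|A| == p.2.+1) &&
  [forall i, forall j, (i \in A) ==> (j \notin A) ==> (y j p.1 + delta <= y i p.1)].

Definition has_gap y p : bool := [exists A, gap_set y p A].

(* The colour is a coordinate and a cardinality; for a subset [A] of [F] with
   [0 < #|A| < r], the element [- (sum of A) / #|A|] increases by [j] when [A] is
   translated by [- j]. *)
Definition gap_label y : nat * F :=
  if [pick p | has_gap y p] is Some p then
    if [pick A | gap_set y p A] is Some A then
      (enum_rank p : nat, - (\sum_(i in A) i) / #|A|%:R)
    else (0%N, 0)
  else (0%N, 0).

Lemma gap_setP y p A i j : gap_set y p A -> i \in A -> j \notin A ->
  y j p.1 + delta <= y i p.1.
Proof. by case/andP=> _ /forallP/(_ i)/forallP/(_ j)/implyP h /h /implyP. Qed.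

(** Distinct sets of equal size give [i] in [A] only and [j] in [B] only. Then [y] puts [i] above
    [j] by [delta] and [z] the reverse, too much for a perturbation below [delta]. *)
Lemma gap_set_unique y z p A B : gap_set y p A -> gap_set z p B ->
  (forall i c, `|y i c - z i c| < delta) -> A = B.
Proof.
move=> yA zB yz; have /andP[/eqP cA _] := yA; have /andP[/eqP cB _] := zB.
apply/eqP; rewrite eqEcard cA cB leqnn andbT; apply/negPn/negP => AB.
have [i iA iNB] := subsetPn AB.
have [j jB jNA] : exists2 j, j \in B & j \notin A.
  apply/subsetPn; apply: contra AB => BA.
  by have /eqP <- : B == A by rewrite eqEcard BA cA cB leqnn.
have := gap_setP yA iA jNA; have := gap_setP zB jB iNB.
have := yz i p.1; have := yz j p.1; rewrite !ltr_norml => /andP[? ?] /andP[? ?].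
lra.
Qed.

Lemma gap_labelE y : (exists p, has_gap y p) -> exists p A,
  [/\ gap_set y p A, [pick p | has_gap y p] = Some p
    & gap_label y = (enum_rank p : nat, - (\sum_(i in A) i) / #|A|%:R)].
Proof.
move=> [p0 yp0]; rewrite /gap_label; case: pickP => [p yp|/(_ p0)]; last by rewrite yp0.
have [A yA] := existsP yp; case: pickP => [B yB|/(_ A)]; last by rewrite yA.
by exists p, B.
Qed.

Lemma gap_label_lt y : (exists p, has_gap y p) -> ((gap_label y).1 < d * r.-1)%N.
Proof.
move=> /gap_labelE[p [A [_ _ ->]]] /=.
by have := ltn_ord (enum_rank p); rewrite [X in (_ < X)%N -> _]card_prod !card_ord.
Qed.

Lemma gap_label_near y z : (exists p, has_gap y p) -> (exists p, has_gap z p) ->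
  (forall i c, `|y i c - z i c| < delta) ->
  (gap_label y).1 = (gap_label z).1 -> gap_label y = gap_label z.
Proof.
move=> /gap_labelE[p [A [yA _ ->]]] /gap_labelE[q [B [zB _ ->]]] yz /= pq.
have /enum_rank_inj epq : enum_rank p = enum_rank q by exact: val_inj.
by subst q; rewrite (gap_set_unique yA zB yz).
Qed.

Lemma card_gap_set_neq0 y p A : gap_set y p A -> #|A|%:R != 0 :> F.
Proof.
case/andP=> /eqP -> _; rewrite -(dvdn_pcharf (pchar_Fp r_prime)) gtnNdvd //.
by have := ltn_ord p.2; have := prime_gt1 r_prime; lia.
Qed.

(** The gap sets of [z] are those of [y] translated by [- j]; the same [p] is picked for both, and
    uniqueness identifies the picked sets. *)
Lemma gap_label_translate y z j : (exists p, has_gap y p) ->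
  (forall i c, z i c = y (i + j) c) ->
  gap_label z = ((gap_label y).1, (gap_label y).2 + j).
Proof.
move=> ygap zy.
pose T A := [set i - j | i in A].
have memT A i : (i \in T A) = (i + j \in A).
  apply/imsetP/idP => [[k kA ->]|iA]; first by rewrite subrK.
  by exists (i + j); rewrite ?addrK.
have cardT A : #|T A| = #|A| by apply/card_imset/addIr.
have gapT p A : gap_set z p (T A) = gap_set y p A.
  rewrite /gap_set cardT; congr (_ && _); apply/forallP/forallP => h i; apply/forallP => k.
    have /forallP/(_ (k - j)) := h (i - j).
    by rewrite !memT !zy !subrK.
  by have /forallP/(_ (k + j)) := h (i + j); rewrite !memT !zy.
have hasE p : has_gap z p = has_gap y p.
  apply/existsP/existsP => [[A zA]|[A yA]]; last by exists (T A); rewrite gapT.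
  exists [set i | i - j \in A]; rewrite -gapT.
  rewrite (_ : T _ = A) //; apply/setP => i.
  by rewrite memT inE addrK.
have zgap : exists p, has_gap z p by have [p yp] := ygap; exists p; rewrite hasE.
have [p [A [yA yp ->]]] := gap_labelE ygap; have [q [B [zB zq ->]]] := gap_labelE zgap.
move: zq; rewrite (eq_pick hasE) yp => -[pq]; subst q.
have -> : B = T A.
  apply: (gap_set_unique (z := z) zB); first by rewrite gapT.
  by move=> i c; rewrite subrr normr0.
rewrite /= cardT big_imset /=; last by move=> ? ? _ _ /addIr.
congr pair; rewrite sumrB sumr_const -mulr_natr.
by have := card_gap_set_neq0 yA => A0; field.
Qed.

(** Pigeonhole: the [r] consecutive open intervals of length [delta] starting at [y j0 c] cannot all
    contain one of the [r] values, since the value at [j0] is an endpoint. The indices above an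
    empty interval form a gap set. *)
Lemma exists_gap y i0 j0 c : y j0 c + r%:R * delta <= y i0 c -> exists p, has_gap y p.
Proof.
move=> yij; pose t (l : nat) := y j0 c + l%:R * delta.
have tS l : t l.+1 = t l + delta by rewrite /t -natr1; ring.
have t_le l m : (l <= m)%N -> t l <= t m.
  by move=> lm; rewrite /t lerD2l ler_wpM2r ?ler_nat // ltW.
have [l lP] : exists l : 'I_r, forall i, ~~ (t l < y i c < t l.+1).
  apply: contrapT => /forallNP h.
  have {}h (l : 'I_r) : exists i, t l < y i c < t l.+1.
    by have /existsNP[i /negP/negPn] := h l; exists i.
  have [phi phiP] := choice h.
  have phi_inj : injective phi.
    have lt (l m : 'I_r) : (l < m)%N -> phi l != phi m.
      move=> lm; apply/eqP => e; have := phiP l; have := phiP m; rewrite e.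
      by have := t_le _ _ lm; move=> ? /andP[? ?] /andP[? ?]; lra.
    move=> l m e; apply/val_inj; have [lm|ml|//] := ltngtP l m.
      by have := lt l m lm; rewrite e eqxx.
    by have := lt m l ml; rewrite e eqxx.
  have /(_ j0) : forall i, i \in codom phi.
    by apply: inj_card_onto => //; rewrite (card_Fp r_prime) card_ord.
  move=> /codomP[l jl]; have := phiP l; rewrite -jl => /andP[].
  by have := t_le 0%N l (leq0n _); rewrite {1}/t mul0r addr0; lra.
pose A := [set i | t l.+1 <= y i c].
have iA : i0 \in A by rewrite inE (le_trans (t_le _ r _)) //; exact: ltn_ord.
have jNA : j0 \notin A.
  rewrite inE -ltNge tS; have := t_le 0%N l (leq0n _).
  by rewrite {1}/t mul0r addr0; have := delta_gt0; lra.
have A0 : (0 < #|A|)%N by apply/card_gt0P; exists i0.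
have Ar : (#|A| < r)%N.
  rewrite -[X in (_ < X)%N](card_Fp r_prime) -cardsT; apply: proper_card.
  by apply/properP; split; [exact: finset.subsetT | exists j0 => //; rewrite finset.in_setT].
have Ap : (#|A|.-1 < r.-1)%N by lia.
exists (c, Ordinal Ap); apply/existsP; exists A; rewrite /gap_set /= prednK // eqxx /=.
apply/forallP => i; apply/forallP => j; apply/implyP; rewrite !inE => iA'.
apply/implyP; rewrite -ltNge => jA'.
have := lP j; rewrite jA' andbT -leNgt => jt.
by move: iA'; rewrite tS; move: jt; lra.
Qed.

End GapLabel.

(** * Points of the sphere *)

Section RotatedJoins.
Variables (R : realType) (r n : nat).
Hypotheses (r_prime : prime r) (n_gt0 : (0 < n)%N).
Local Notation F := 'F_r.
Implicit Types (x y : nat -> R) (i j k : nat).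

Definition turn (u : R) : R := pi *+ 2 * (u / r%:R).

Lemma turnD u v : turn (u + v) = turn u + turn v.
Proof. by rewrite /turn; ring. Qed.

Lemma turn_full : turn r%:R = pi *+ 2.
Proof. by rewrite /turn divff ?mulr1 // pnatr_eq0 -lt0n prime_gt0. Qed.

Lemma trig_turn_mod (u : R) j : cos (turn (u + (j %% r)%:R)) = cos (turn (u + j%:R)) /\
  sin (turn (u + (j %% r)%:R)) = sin (turn (u + j%:R)).
Proof.
rewrite {2 4}(divn_eq j r); elim: (j %/ r)%N => [|q [IHc IHs]]; first by rewrite mul0n add0n.
have -> : turn (u + (q.+1 * r + j %% r)%:R) = turn (u + (q * r + j %% r)%:R) + pi *+ 2.
  by rewrite -turn_full -turnD mulSn !natrD; congr turn; ring.
by rewrite IHc IHs cosD2pi sinD2pi.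
Qed.

(* A point of R^oo is read as a sequence of complex numbers [x_(2k) + i x_(2k+1)],
   all multiplied by [exp (2 pi i j / r)]. *)
Definition rotate j x : nat -> R := fun i =>
  if odd i then sin (turn j%:R) * x i.-1 + cos (turn j%:R) * x i
  else cos (turn j%:R) * x i - sin (turn j%:R) * x i.+1.

Lemma rotateD j k x : rotate j (rotate k x) = rotate (j + k) x.
Proof.
apply/funext => i; rewrite /rotate natrD turnD cosD sinD.
case: (boolP (odd i)) => oi; last by rewrite /= oi /=; ring.
by case: i oi => //= i /negbTE ->; ring.
Qed.

Lemma rotate_mod j x : rotate (j %% r)%N x = rotate j x.
Proof.
have [ec es] := trig_turn_mod 0 j; rewrite !add0r in ec es.
by apply/funext => i; rewrite /rotate ec es.
Qed.

Lemma val_FpD (j k : F) : nat_of_ord (j + k) = ((j + k) %% r)%N.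
Proof. by rewrite /=; congr modn; exact: Fp_cast. Qed.

Definition grid_param (u : nat) : R := (minn u n.*2)%:R / n.*2%:R.

Lemma grid_param0 : grid_param 0 = 0.
Proof. by rewrite /grid_param min0n mul0r. Qed.

Lemma grid_param1 : grid_param n.*2 = 1.
Proof. by rewrite /grid_param minnn divff // pnatr_eq0 double_eq0 -lt0n. Qed.

(** The arc of the [k]-th coordinate circle between the [r]-th roots of unity of indices [j] and
    [j + 1]. *)
Definition arc k (j : F) u : nat -> R := fun i =>
  if i./2 == k then
    let t := turn ((j : nat)%:R + grid_param u) in if odd i then sin t else cos t
  else 0.

(** The spherical join: a quarter of a great circle from [x] to [y] when these are orthogonal unit
    vectors. *)
Definition join t x y : nat -> R := fun i =>
  cos (pi / 2 * grid_param t) * x i + sin (pi / 2 * grid_param t) * y i.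

Lemma join_left x y : join 0 x y = x.
Proof.
by apply/funext => i; rewrite /join grid_param0 mulr0 cos0 sin0 mul1r mul0r addr0.
Qed.

Lemma join_right x y : join n.*2 x y = y.
Proof.
apply/funext => i.
by rewrite /join grid_param1 mulr1 cos_pihalf sin_pihalf mul1r mul0r add0r.
Qed.

Lemma turn_FpD (j k : F) (u : R) :
  cos (turn ((j + k)%R%:R + u)) = cos (turn (j%:R + (u + k%:R))) /\
  sin (turn ((j + k)%R%:R + u)) = sin (turn (j%:R + (u + k%:R))).
Proof.
have [ec es] := trig_turn_mod u (j + k); move: ec es.
by rewrite -val_FpD natrD addrC [u + k%:R]addrC [u + _]addrC addrA.
Qed.

Lemma arc_end k (j : F) : arc k j n.*2 = arc k (j + 1) 0.
Proof.
have [ec es] := turn_FpD j 1 0.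
have one : ((1%R : F) : nat)%:R = 1 :> R by rewrite /= modn_small.
apply/funext => i; rewrite /arc /= grid_param0 grid_param1 ec es add0r.
by rewrite one.
Qed.

Lemma rotate_join j t x y : rotate j (join t x y) = join t (rotate j x) (rotate j y).
Proof.
by apply/funext => i; rewrite /rotate /join; case: odd; ring.
Qed.

Lemma rotate_arc (j : F) k l u : rotate j (arc k l u) = arc k (l + j) u.
Proof.
have [ec es] := turn_FpD l j (grid_param u).
apply/funext => i; rewrite /rotate /arc ec es addrA (turnD (_ + grid_param u)) cosD sinD.
case: (boolP (odd i)) => oi /=.
  have -> : i.-1./2 = i./2 by case: i oi => //= i; rewrite uphalf_half => /negbTE ->.
  have -> : odd i.-1 = false by case: i oi => //= i /negbTE.
  by case: eqP => _; ring.
rewrite oi /= uphalf_half (negbTE oi) add0n.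
by case: eqP => _; ring.
Qed.

Local Notation point := (join_cube join arc).

Lemma rotate_point (j : F) k js a : size js = k.+1 ->
  rotate j (point k js a) = point k [seq l + j | l <- js] a.
Proof.
elim: k js a => [|k IH] [|l js] a //= [sjs]; first by rewrite rotate_arc.
by rewrite rotate_join IH // rotate_arc.
Qed.

(** Spheres of all dimensions are kept inside R^oo, so that iterated joins share one type of
    points. *)
Definition on_sphere (m : nat) x : Prop :=
  (forall i, (m <= i)%N -> x i = 0) /\ \sum_(i < m) x i ^+ 2 = 1.

Lemma sum_sqr_support m p x : (m <= p)%N -> (forall i, (m <= i)%N -> x i = 0) ->
  \sum_(i < p) x i ^+ 2 = \sum_(i < m) x i ^+ 2.
Proof.
move=> /subnKC <- x0; rewrite big_split_ord /= [X in _ + X]big1 ?addr0 // => i _.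
by rewrite x0 ?expr0n // leq_addr.
Qed.

Lemma on_sphere_widen m p x : (m <= p)%N -> on_sphere m x -> on_sphere p x.
Proof.
clear r_prime n_gt0.
move=> mp [x0 x1]; split=> [i pi|]; first by apply: x0; lia.
by rewrite (sum_sqr_support mp).
Qed.

Lemma on_sphere_le1 m x i : on_sphere m x -> `|x i| <= 1.
Proof.
move=> [x0 x1]; have [im|/x0 ->] := ltnP i m; last by rewrite normr0.
rewrite -(@ler_pXn2r _ 2) ?nnegrE // expr1n real_normK ?num_real // -x1.
by rewrite (bigD1 (Ordinal im)) //= lerDl sumr_ge0 // => j _; exact: sqr_ge0.
Qed.

Lemma sum_double m (f : nat -> R) :
  \sum_(i < m.*2) f i = \sum_(i < m) (f i.*2 + f i.*2.+1).
Proof.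
elim: m => [|m IH]; first by rewrite !big_ord0.
by rewrite doubleS !big_ord_recr /= IH addrA.
Qed.

Lemma on_sphere_rotate m j x : on_sphere m.*2 x -> on_sphere m.*2 (rotate j x).
Proof.
clear r_prime n_gt0.
move=> [x0 x1]; split=> [i mi|].
  rewrite /rotate; case: ifP => oi; first by rewrite !x0 ?mulr0 ?addr0 //; lia.
  by rewrite !x0 ?mulr0 ?subr0 //; lia.
rewrite -x1 (sum_double _ (fun i => rotate j x i ^+ 2)) (sum_double _ (fun i => x i ^+ 2)).
apply: eq_bigr => i _; rewrite /rotate /= odd_double /=.
transitivity ((cos (turn j%:R) ^+ 2 + sin (turn j%:R) ^+ 2) * (x i.*2 ^+ 2 + x i.*2.+1 ^+ 2)).
  by ring.
by rewrite cos2Dsin2 mul1r.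
Qed.

Lemma dot_rotate m j x : on_sphere m.*2 x ->
  \sum_(i < m.*2) x i * rotate j x i = cos (turn j%:R).
Proof.
move=> [_ x1]; transitivity (cos (turn j%:R) * \sum_(i < m.*2) x i ^+ 2); last by rewrite x1 mulr1.
rewrite (sum_double _ (fun i => x i * rotate j x i)) (sum_double _ (fun i => x i ^+ 2)).
rewrite mulr_sumr; apply: eq_bigr => i _; rewrite /rotate /= odd_double /=.
by ring.
Qed.

(** Each new arc lives on two fresh coordinates, orthogonal to the inner join, so the squared norm
    is a sum of squares of a cosine and a sine. *)
Lemma on_sphere_point k js a : on_sphere k.+1.*2 (point k js a).
Proof.
clear r_prime n_gt0.
elim: k js a => [|k IH] js a.
  split=> [i i2|]; first by rewrite /= /arc; case: eqP => //; lia.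
  by rewrite !big_ord_recr big_ord0 /= /arc /= add0r; exact: cos2Dsin2.
have [x0 x1] := IH (behead js) (drop 2 a); split=> [i ik|].
  rewrite /= /join x0 ?mulr0 ?add0r; last by lia.
  by rewrite /arc; case: eqP; rewrite ?mulr0 //; lia.
set x := join_cube _ _ _ _ _ in x0 x1.
have -> : point k.+1 js a = join (nth 0%N a 1) x (arc k.+1 (head 0 js) (head 0%N a)) by [].
have m2 : k.+1.*2./2 = k.+1 by rewrite doubleK.
have om : odd k.+1.*2 = false by rewrite odd_double.
rewrite doubleS; move: k.+1.*2 m2 om x0 x1 => m m2 om x0 x1.
rewrite 2!big_ord_recr /=.
rewrite (eq_bigr (fun i : 'I__ => cos (pi / 2 * grid_param (nth 0%N a 1)) ^+ 2 * x i ^+ 2)).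
  rewrite -mulr_sumr x1 /join !x0 // /arc /= uphalf_half om m2 eqxx /=.
  set u := turn _; set v := pi / 2 * _.
  by rewrite !mulr0 !add0r !exprMn -addrA -mulrDr cos2Dsin2 !mulr1 cos2Dsin2.
move=> i _; rewrite /join /arc; have := ltn_ord i; case: eqP => [|_ _]; first by lia.
by ring.
Qed.

(** The addition formulas reduce uniform continuity to continuity at 0. *)
Lemma trig_close (e : R) : 0 < e -> exists2 h : R, 0 < h &
  forall u v : R, `|u - v| < h -> `|cos u - cos v| < e /\ `|sin u - sin v| < e.
Proof.
move=> e0; have e20 : 0 < e / 2 by lra.
have /cvgrPdist_lt/(_ _ e20)/nbhs_ballP[h1 /= h10 H1] := @continuous_cos R 0.
have /cvgrPdist_lt/(_ _ e20)/nbhs_ballP[h2 /= h20 H2] := @continuous_sin R 0.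
exists (Num.min h1 h2) => [|u v]; first by rewrite lt_min h10 h20.
rewrite lt_min => /andP[uv1 uv2].
have := H1 (u - v); rewrite /ball /= sub0r normrN => /(_ uv1); rewrite cos0 => c1.
have := H2 (u - v); rewrite /ball /= sub0r normrN => /(_ uv2); rewrite sin0 sub0r normrN => s1.
have ec : cos u - cos v = - (cos v * (1 - cos (u - v))) - sin v * sin (u - v).
  by have := cosD (u - v) v; rewrite subrK => ->; ring.
have es : sin u - sin v = cos v * sin (u - v) - sin v * (1 - cos (u - v)).
  by have := sinD (u - v) v; rewrite subrK => ->; ring.
have bound (p q p' q' : R) : `|p| <= 1 -> `|q| <= 1 -> `|p'| < e / 2 -> `|q'| < e / 2 ->
    `|p * p' - q * q'| < e /\ `|- (p * p') - q * q'| < e.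
  move=> p1 q1 p2 q2.
  have A : `|p * p'| < e / 2 by rewrite normrM; apply: le_lt_trans p2; rewrite ler_piMl.
  have B : `|q * q'| < e / 2 by rewrite normrM; apply: le_lt_trans q2; rewrite ler_piMl.
  split; first by apply: (le_lt_trans (ler_normB _ _)); lra.
  by apply: (le_lt_trans (ler_normB _ _)); rewrite normrN; lra.
rewrite ec es; split.
  by apply: (bound _ _ _ _ _ _ _ _).2 => //; [exact: cos_max | exact: sin_max].
by apply: (bound _ _ _ _ _ _ _ _).1 => //; [exact: cos_max | exact: sin_max].
Qed.

Lemma cell_vertices_near a v w i : v \in cell_vertices a -> w \in cell_vertices a ->
  (nth 0%N v i <= nth 0%N w i + 2)%N.
Proof.
clear r_prime n_gt0.
elim: a v w i => [|x a IH] v w i /=; first by rewrite !inE => /eqP -> /eqP ->; lia.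
case: ifP => _; rewrite ?mem_cat => /[swap]; last first.
  by move=> /mapP[w' wa ->] /mapP[v' va ->]; case: i => [|i] /=; [lia | exact: IH].
by move=> /orP[] /mapP[w' wa ->] /orP[] /mapP[v' va ->]; case: i => [|i] /=;
  [lia | exact: IH | lia | exact: IH | lia | exact: IH | lia | exact: IH].
Qed.

Lemma grid_param_near u v : (u <= v + 2)%N -> (v <= u + 2)%N ->
  `|grid_param u - grid_param v| <= n%:R^-1.
Proof.
move=> uv vu; have n0 : 0 < n%:R :> R by rewrite ltr0n.
have -> : n%:R^-1 = 2 / n.*2%:R :> R by rewrite -muln2 natrM; field; lra.
rewrite /grid_param -mulrBl normrM [X in _ * X]ger0_norm ?invr_ge0 ?ler0n //.
rewrite ler_wpM2r ?invr_ge0 ?ler0n //.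
have uv' : (minn u n.*2 <= minn v n.*2 + 2)%N by lia.
have vu' : (minn v n.*2 <= minn u n.*2 + 2)%N by lia.
move: uv' vu'; rewrite -!(ler_nat R) !natrD => ? ?.
by rewrite ler_norml; apply/andP; split; lra.
Qed.

Section Nearness.
Variables (e h : R).
Hypothesis e_ge0 : 0 <= e.
Hypothesis trig_e :
  forall s t : R, `|s - t| < h -> `|cos s - cos t| < e /\ `|sin s - sin t| < e.
Hypothesis n_large : pi / n%:R < h.

Lemma arc_near k (j : F) u v i : (u <= v + 2)%N -> (v <= u + 2)%N ->
  `|arc k j u i - arc k j v i| <= e.
Proof.
move=> uv vu; rewrite /arc; case: eqP => _; last by rewrite subrr normr0.
set s := turn _; set t := turn _.
have : `|s - t| < h.
  apply: le_lt_trans n_large.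
  have -> : s - t = pi * (2 / r%:R * (grid_param u - grid_param v)).
    by rewrite /s /t /turn; ring.
  rewrite normrM ger0_norm ?pi_ge0 // ler_wpM2l ?pi_ge0 //.
  rewrite normrM; apply: le_trans (grid_param_near uv vu).
  rewrite ler_piMl // ger0_norm ?divr_ge0 ?ler0n //.
  by rewrite ler_pdivrMr ?mul1r ?ltr0n ?ler_nat ?prime_gt1 ?prime_gt0.
by case/trig_e => ? ?; case: odd; exact: ltW.
Qed.

(** Each join adds three errors of size [e]: from the cosine, from the sine and from the arc. *)
Lemma join_near s t x y x' y' i (b : R) : (s <= t + 2)%N -> (t <= s + 2)%N ->
  `|x i| <= 1 -> `|y i| <= 1 -> `|x i - x' i| <= b -> `|y i - y' i| <= e ->
  `|join s x y i - join t x' y' i| <= b + 3 * e.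
Proof.
move=> st ts x1 y1 xb ye; rewrite /join; set u := pi / 2 * _; set v := pi / 2 * _.
have : `|u - v| < h.
  apply: le_lt_trans n_large.
  rewrite /u /v -mulrBr normrM ger0_norm ?divr_ge0 ?pi_ge0 //.
  apply: ler_pM => //; first by rewrite divr_ge0 // pi_ge0.
    by have := pi_ge0 R; lra.
  exact: grid_param_near.
case/trig_e => /ltW cu /ltW su.
have -> : cos u * x i + sin u * y i - (cos v * x' i + sin v * y' i) =
  (cos u - cos v) * x i + cos v * (x i - x' i) +
  ((sin u - sin v) * y i + sin v * (y i - y' i)) by ring.
have bound (p q c : R) : `|p| <= 1 -> `|q| <= c -> `|p * q| <= c.
  by move=> p1 qc; rewrite normrM; apply: le_trans qc; rewrite ler_piMl.
have A1 := bound _ _ _ x1 cu; have A2 := bound _ _ _ y1 su.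
have A3 := bound _ _ _ (cos_max v) xb; have A4 := bound _ _ _ (sin_max v) ye.
rewrite mulrC in A1; rewrite mulrC in A2.
apply: (le_trans (ler_normD _ _)).
have := ler_normD ((cos u - cos v) * x i) (cos v * (x i - x' i)).
have := ler_normD ((sin u - sin v) * y i) (sin v * (y i - y' i)).
lra.
Qed.

Lemma arc_le1 k (j : F) u i : `|arc k j u i| <= 1.
Proof.
rewrite /arc; case: eqP => _; last by rewrite normr0 ler01.
by case: odd; [exact: sin_max | exact: cos_max].
Qed.

Lemma point_near_of_grid k js v w i :
  (forall l, nth 0 v l <= nth 0 w l + 2)%N -> (forall l, nth 0 w l <= nth 0 v l + 2)%N ->
  `|point k js v i - point k js w i| <= (3 * k.+1)%:R * e.
Proof.
elim: k js v w => [|k IH] js v w vw wv.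
  have := vw 0%N; have := wv 0%N; rewrite !nth0 => wv0 vw0 /=.
  by apply: (le_trans (arc_near _ _ _ vw0 wv0)); rewrite muln1; have := e_ge0; lra.
have -> : (3 * k.+2)%:R * e = (3 * k.+1)%:R * e + 3 * e by rewrite mulnS natrD; ring.
apply: join_near => //=.
- exact: on_sphere_le1 (on_sphere_point _ _ _).
- exact: arc_le1.
- by apply: IH => l; rewrite !nth_drop.
have := vw 0%N; have := wv 0%N; rewrite !nth0 => wv0 vw0 /=.
exact: arc_near.
Qed.

Lemma point_near k js a v w i : v \in cell_vertices a -> w \in cell_vertices a ->
  `|point k js v i - point k js w i| <= (3 * k.+1)%:R * e.
Proof.
by move=> va wa; apply: point_near_of_grid => l; exact: (@cell_vertices_near a).
Qed.

End Nearness.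
End RotatedJoins.

(** * Equivariant coincidences *)

Local Open Scope classical_set_scope.

Lemma rotate_near (R : realType) r j (x y : nat -> R) (e : R) :
  (forall i, `|x i - y i| < e / 2) ->
  forall i, `|rotate r j x i - rotate r j y i| < e.
Proof.
move=> xy i; set c := cos (turn r j%:R : R); set s := sin (turn r j%:R : R).
have bound (p q t u : R) : `|p| <= 1 -> `|q| <= 1 -> `|t| < e / 2 -> `|u| < e / 2 ->
    `|p * t + q * u| < e.
  move=> p1 q1 te ue; apply: (le_lt_trans (ler_normD _ _)); rewrite !normrM.
  have : `|p| * `|t| <= `|t| by rewrite ler_piMl.
  have : `|q| * `|u| <= `|u| by rewrite ler_piMl.
  by lra.
rewrite /rotate -/c -/s; case: odd.
  have -> : s * x i.-1 + c * x i - (s * y i.-1 + c * y i) =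
    s * (x i.-1 - y i.-1) + c * (x i - y i) by ring.
  by apply: bound; rewrite ?cos_max ?sin_max.
have -> : c * x i - s * x i.+1 - (c * y i - s * y i.+1) =
  c * (x i - y i) + (- s) * (x i.+1 - y i.+1) by ring.
by apply: bound; rewrite ?normrN ?cos_max ?sin_max.
Qed.

(** If every point had a gap, [gap_label] would be an equivariant labelling with [d * (r - 1)]
    colours of a grid fine enough for consistency, which [equivariant_labelling_colours] forbids. *)
Lemma exists_no_gap (R : realType) r d (g : (nat -> R) -> 'I_d -> R) (delta eta : R)
    (m := (d * r.-1)./2.+1.*2) : prime r -> 0 < delta -> 0 < eta ->
  (forall x y, on_sphere m x -> on_sphere m y -> (forall i, `|x i - y i| < eta) ->
    forall c, `|g x c - g y c| < delta) ->
  exists2 x, on_sphere m x &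
    forall p, ~~ has_gap delta (fun (i : 'F_r) c => g (rotate r i x) c) p.
Proof.
move=> r_prime delta0 eta0 g_near; apply: contrapT => no_x.
pose K := (d * r.-1)./2; pose Y x (i : 'F_r) c := g (rotate r i x) c.
have gap x : on_sphere m x -> exists p, has_gap delta (Y x) p.
  move=> xm; apply: contrapT => /forallNP h; apply: no_x; exists x => // p.
  exact/negP/h.
(* [point_near] then bounds distances inside a cell by [eta / 4], within the [eta / 2] that
   [rotate_near] asks for. *)
pose e := eta / (4 * (3 * K.+1)%:R).
have K0 : 0 < (3 * K.+1)%:R :> R by rewrite ltr0n.
have e0 : 0 < e by rewrite divr_gt0 // mulr_gt0.
have [h h0 trig_h] := trig_close e0.
pose n := (Num.truncn (pi / h : R)).+1.
have n_large : pi / n%:R < h.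
  rewrite ltr_pdivrMr ?ltr0n // -ltr_pdivrMl // mulrC.
  exact: truncnS_gt.
have n0 : (0 < n)%N by [].
have point_on k js a : (k <= K)%N -> on_sphere m (join_cube (@join R n) (@arc R r n) k js a).
  move=> kK; apply: (on_sphere_widen _ (@on_sphere_point R r n k js a)).
  by rewrite /m -/K; lia.
pose lab x := gap_label delta (Y x).
refine (@equivariant_labelling_colours r _ n r_prime (@join R n) (@arc R r n) _ _ _ lab K _ _ (d * r.-1)%N _ _).
- exact: join_left.
- exact: join_right.
- exact: arc_end.
- move=> k js j a kK sjs; rewrite -rotate_point //.
  apply: gap_label_translate => //; first exact/gap/point_on.
  by move=> i c; rewrite /Y rotateD val_FpD // rotate_mod.
- move=> k js kK sjs a l1 l2 /mapP[v va ->] /mapP[w wa ->].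
  apply: gap_label_near => //; do ?exact/gap/point_on.
  move=> i c; apply: g_near.
  + exact/on_sphere_rotate/point_on.
  + exact/on_sphere_rotate/point_on.
  apply: rotate_near => l.
  apply: le_lt_trans (point_near r_prime n0 (ltW e0) trig_h n_large _ _ _ va wa) _.
  apply: (@le_lt_trans _ _ ((3 * K.+1)%:R * e)).
    by rewrite ler_pM2r // ler_nat; lia.
  rewrite /e; move: K0; move: (_%:R) => q q0.
  have -> : q * (eta / (4 * q)) = eta / 4 by field; rewrite gt_eqF.
  by lra.
- by [].
by move=> k js a kK _; apply/gap_label_lt/gap/point_on.
Qed.

(** * Uniform continuity and compact spheres *)

Section Compactness.
Variable R : realType.

Lemma within_continuousP n d (A : set 'rV[R]_n) (f : 'rV[R]_n -> 'rV[R]_d) :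
  {within A, continuous f} -> forall x, A x -> forall e : R, 0 < e ->
  exists2 h : R, 0 < h & forall y, A y -> (forall i, `|x 0 i - y 0 i| < h) ->
    forall c, `|f x 0 c - f y 0 c| < e.
Proof.
move=> /subspace_continuousP cf x Ax e e0.
have /cvg_ballP/(_ _ e0) := cf x Ax.
rewrite /within /= => /nbhs_ballP[h /= h0 hP]; exists h => // y Ay xy c.
have xy' : ball x h y by split=> // i j; rewrite (ord1 i); exact: xy.
by have [_] := hP _ xy' Ay; apply.
Qed.

Lemma compact_uniform n d (A : set 'rV[R]_n) (f : 'rV[R]_n -> 'rV[R]_d) :
  compact A -> {within A, continuous f} -> forall e : R, 0 < e ->
  exists2 h : R, 0 < h & forall x y, A x -> A y -> (forall i, `|x 0 i - y 0 i| < h) ->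
    forall c, `|f x 0 c - f y 0 c| < e.
Proof.
move=> /compact_near_coveringP/near_covering_withinP cA cf e e0.
have e20 : 0 < e / 2 by lra.
have cover : forall x, A x -> \forall x' \near x & h \near 0^'+, A x' ->
   forall y, A y -> (forall i, `|x' 0 i - y 0 i| < h) -> forall c, `|f x' 0 c - f y 0 c| < e.
  move=> x Ax; have [h0 h00 hP] := within_continuousP cf Ax e20.
  have h20 : 0 < h0 / 2 by lra.
  exists (ball x (h0 / 2), [set h | h < h0 / 2]) => /=.
    by split; [exact: nbhsx_ballx | exact: nbhs_right_lt].
  move=> [x' h] /= [[_ xx'] hh] Ax' y Ay x'y c.
  have A1 := hP _ Ax' (fun i => lt_trans (xx' 0 i) (_ : h0 / 2 < h0)).
  have {}A1 : `|f x 0 c - f x' 0 c| < e / 2 by apply: A1; lra.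
  have A2 : `|f x 0 c - f y 0 c| < e / 2.
    apply: hP => // i; have := xx' 0 i; have := x'y i; rewrite /ball /= => ? ?.
    have -> : x 0 i - y 0 i = (x 0 i - x' 0 i) + (x' 0 i - y 0 i) by ring.
    by apply: (le_lt_trans (ler_normD _ _)); lra.
  have -> : f x' 0 c - f y 0 c = - (f x 0 c - f x' 0 c) + (f x 0 c - f y 0 c) by ring.
  by apply: (le_lt_trans (ler_normD _ _)); rewrite normrN; lra.
have near0 := cA R (0^'+) (fun h x => forall y, A y ->
  (forall i, `|x 0 i - y 0 i| < h) -> forall c, `|f x 0 c - f y 0 c| < e) _ cover.
have [h [hP h0]] := @filter_ex _ (0 : R)^'+ _ _ (filterI (near0 _) (nbhs_right_gt 0)).
by exists h => // x y Ax Ay xy c; apply: hP.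
Qed.

Lemma continuous_dotv n : continuous (fun x : 'rV[R]_n => dotv x x).
Proof.
move=> x; apply: cvg_big; [exact: add_continuous | exact: mx_nbhs_filter | move=> i _].
by apply: cvgM; [exact: mx_nbhs_filter | exact: (@coord_continuous R 1 n 0 i x)..].
Qed.

(** The great sphere of the first [p] coordinates. The rotation acts on it when [p] is even,
    whatever the parity of [m]. *)
Lemma compact_sphere_section m p : compact [set x : 'rV[R]_m |
  dotv x x = 1 /\ forall i : 'I_m, (p <= i)%N -> x 0 i = 0].
Proof.
apply: bounded_closed_compact.
  exists 1; split; first exact: num_real.
  move=> M M1 x /= [x1 _]; apply: le_trans (ltW M1).
  rewrite -[`|x|]/(mx_norm x) mx_normrE; apply: bigmax_le => // -[i j] _ /=.
  rewrite (ord1 i) -(@ler_pXn2r _ 2) ?nnegrE // expr1n real_normK ?num_real // -x1.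
  by rewrite /dotv (bigD1 j) //= -expr2 lerDl sumr_ge0 // => k _; rewrite -expr2 sqr_ge0.
rewrite (_ : [set x | _] = (fun x : 'rV[R]_m => dotv x x) @^-1` [set x | x = 1] `&`
   \bigcap_(i in [set i : 'I_m | (p <= i)%N])
     (fun x : 'rV[R]_m => x 0 i) @^-1` [set x | x = 0]); last first.
  by apply/seteqP; split=> x /= [x1 x0]; split=> // i; exact: x0.
apply: closedI.
  apply: preimage_closed; last exact: closed_eq.
  by move=> x _; exact: continuous_dotv.
apply: closed_bigI => i _; apply: preimage_closed; last exact: closed_eq.
by move=> x _; exact: coord_continuous.
Qed.

Lemma compact_unit_sphere m : compact (@unit_sphere R m).
Proof.
rewrite (_ : @unit_sphere R m = [set x : 'rV[R]_m |
  dotv x x = 1 /\ forall i : 'I_m, (m <= i)%N -> x 0 i = 0]).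
  exact: compact_sphere_section.
apply/seteqP; split=> x /=; last by case.
by move=> x1; split=> // i; rewrite leqNgt ltn_ord.
Qed.

End Compactness.

Section Coincidence.
Variables (R : realType) (m : nat).

Definition row_of (x : nat -> R) : 'rV[R]_m := \row_(i < m) x i.

Definition seq_of (y : 'rV[R]_m) : nat -> R :=
  fun i => if insub i is Some i' then y 0 i' else 0.

Lemma seq_of_ord y (i : 'I_m) : seq_of y i = y 0 i.
Proof. by rewrite /seq_of valK. Qed.

Lemma row_of_sphere p x : (p <= m)%N -> on_sphere p x -> unit_sphere (row_of x).
Proof.
move=> pm /(on_sphere_widen pm)[_ x1]; rewrite /unit_sphere /= -x1.
by apply: eq_bigr => i _; rewrite !mxE expr2.
Qed.

(** Without a coincidence, compactness gives a uniform [mu] such that at every point some coordinate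
    spreads by [mu] over the rotations. This forces gaps of size [mu / r] everywhere, contrary to
    [exists_no_gap]. *)
Lemma equivariant_coincidence r d (G : 'rV[R]_m -> 'rV[R]_d) :
  prime r -> (d * r.-1 + 2 <= m)%N -> {within @unit_sphere R m, continuous G} ->
  exists x, on_sphere (d * r.-1)./2.+1.*2 x /\
    forall i j : 'F_r, G (row_of (rotate r i x)) = G (row_of (rotate r j x)).
Proof.
move=> r_prime md cG; set p := (d * r.-1)./2.+1.*2.
have pm : (p <= m)%N by rewrite /p; lia.
apply: contrapT => no_x.
pose g (x : nat -> R) (c : 'I_d) : R := G (row_of x) 0 c.
pose C := [set y : 'rV[R]_m | dotv y y = 1 /\ forall i : 'I_m, (p <= i)%N -> y 0 i = 0].
have seqC y : C y -> on_sphere p (seq_of y).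
  move=> [y1 y0].
  have z i : (p <= i)%N -> seq_of y i = 0.
    by move=> pi; rewrite /seq_of; case: insubP => // i' _ ii'; rewrite y0 // ii'.
  split=> //; rewrite -y1 -(sum_sqr_support pm z).
  by apply: eq_bigr => i _; rewrite seq_of_ord expr2.
have row_seq y : row_of (seq_of y) = y.
  by apply/rowP => i; rewrite mxE seq_of_ord.
have rot_sphere x i : on_sphere p x -> unit_sphere (row_of (rotate r i x)).
  by move=> xp; apply: (row_of_sphere pm); exact: on_sphere_rotate.
have unif := compact_uniform (@compact_unit_sphere R m) cG.
have [mu mu0 muP] : exists2 mu : R, 0 < mu & forall x, on_sphere p x ->
    exists (i j : 'F_r) c, mu <= g (rotate r i x) c - g (rotate r j x) c.
  have := @compact_sphere_section R m p.
  move=> /compact_near_coveringP/near_covering_withinP cC.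
  pose D (t : 'F_r * 'F_r * 'I_d) x : R := g (rotate r t.1.1 x) t.2 - g (rotate r t.1.2 x) t.2.
  have cover : forall y, C y -> \forall y' \near y & mu \near 0^'+, C y' ->
      exists t, mu <= D t (seq_of y').
    move=> y Cy; have ys := seqC _ Cy.
    have [t t0] : exists t, 0 < D t (seq_of y).
      apply: contrapT => /forallNP h; apply: no_x; exists (seq_of y); split=> // i j.
      apply/rowP => c; apply/eqP; rewrite eq_le; apply/andP; split; rewrite -subr_le0 leNgt; apply/negP.
        exact: (h (i, j, c)).
      exact: (h (j, i, c)).
    have t40 : 0 < D t (seq_of y) / 4 by lra.
    have [h h0 hP] := unif _ t40.
    have h20 : 0 < h / 2 by lra.
    exists (ball y (h / 2), [set mu | mu < D t (seq_of y) / 2]) => /=.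
      by split; [exact: nbhsx_ballx | apply: nbhs_right_lt; lra].
    move=> [y' mu] /= [[_ yy'] mut] Cy'; exists t.
    have ys' := seqC _ Cy'.
    (* Two errors below a quarter of the difference leave more than half of it, hence more than
       [mu]. *)
    have near i : `|g (rotate r i (seq_of y)) t.2 - g (rotate r i (seq_of y')) t.2| < D t (seq_of y) / 4.
      apply: hP; [exact: rot_sphere | exact: rot_sphere | move=> l; rewrite !mxE].
      apply: rotate_near => k; rewrite /seq_of; case: insubP => [k' _ _|_]; first exact: yy'.
      by rewrite subrr normr0.
    have := near t.1.1; have := near t.1.2; move: mut; rewrite !ltr_norml /D.
    by move=> ? /andP[? ?] /andP[? ?]; lra.
  have near0 := cC R (0^'+) (fun mu y => exists t, mu <= D t (seq_of y)) _ cover.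
  have [mu [muP mu0]] := @filter_ex _ (0 : R)^'+ _ _ (filterI (near0 _) (nbhs_right_gt 0)).
  exists mu => // x xp.
  have xC : C (row_of x).
    split; first exact: (row_of_sphere pm).
    by move=> i pi; rewrite mxE xp.1.
  have [[[i j] c] ijc] := muP _ xC; exists i, j, c.
  move: ijc; rewrite /D /=; suff -> : seq_of (row_of x) = x by [].
  apply/funext => k; rewrite /seq_of; case: insubP => [k' _ <-|]; first by rewrite mxE.
  by rewrite -leqNgt => mk; rewrite xp.1 //; exact: leq_trans pm mk.
have r0 : 0 < r%:R :> R by rewrite ltr0n prime_gt0.
have delta0 : 0 < mu / r%:R by rewrite divr_gt0.
have [h h0 hP] := unif _ delta0.
have [|x xp no_gap] := @exists_no_gap R r d g _ _ r_prime delta0 h0.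
  move=> x y xp yp xy c; apply: hP; try exact: (row_of_sphere pm).
  by move=> i; rewrite !mxE.
have [i [j [c ijc]]] := muP x xp.
have [q] : exists q, has_gap (mu / r%:R) (fun (i : 'F_r) c => g (rotate r i x) c) q.
  apply: (exists_gap r_prime delta0 (i0 := i) (j0 := j) (c := c)).
  by rewrite [r%:R * _]mulrC divfK ?gt_eqF //; lra.
by apply/negP.
Qed.

End Coincidence.

(** * Proper faces of a polytope *)

Local Open Scope ring_scope.

Section DotProduct.
Variables (R : realType) (n : nat).
Implicit Types (x y z : 'rV[R]_n).

Lemma dotvC x y : dotv x y = dotv y x.
Proof. by apply: eq_bigr => i _; rewrite mulrC. Qed.

Lemma dotvDr x y z : dotv x (y + z) = dotv x y + dotv x z.
Proof. by rewrite /dotv -big_split; apply: eq_bigr => i _; rewrite !mxE mulrDr. Qed.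

Lemma dotvZr a x y : dotv x (a *: y) = a * dotv x y.
Proof. by rewrite /dotv mulr_sumr; apply: eq_bigr => i _; rewrite !mxE mulrCA. Qed.

Lemma dotvZl a x y : dotv (a *: x) y = a * dotv x y.
Proof. by rewrite dotvC dotvZr dotvC. Qed.

Lemma dotvBr x y z : dotv x (y - z) = dotv x y - dotv x z.
Proof. by rewrite dotvDr -scaleN1r dotvZr mulN1r. Qed.

Lemma dotvBl x y z : dotv (x - y) z = dotv x z - dotv y z.
Proof. by rewrite dotvC dotvBr !(dotvC z). Qed.

Lemma dotv_sumr (k : nat) x (a : 'I_k -> R) (p : 'I_k -> 'rV[R]_n) :
  dotv x (\sum_(i < k) a i *: p i) = \sum_(i < k) a i * dotv x (p i).
Proof.
elim/big_ind2 : _ => [|u1 u2 v1 v2 e1 e2|i _]; last exact: dotvZr.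
  by rewrite /dotv big1 // => i _; rewrite mxE mulr0.
by rewrite dotvDr e1 e2.
Qed.

Lemma dotv_ge0 x : 0 <= dotv x x.
Proof. by apply: sumr_ge0 => i _; rewrite -expr2 sqr_ge0. Qed.

Lemma dotv_eq0 x : dotv x x = 0 -> x = 0.
Proof.
move=> /eqP; rewrite psumr_eq0 => [/allP x0|i _]; last by rewrite -expr2 sqr_ge0.
apply/rowP => i; rewrite mxE; apply/eqP; rewrite -sqrf_eq0 expr2.
by rewrite (implyP (x0 i _)) ?mem_index_enum.
Qed.

Lemma dotv_gt0 x : x != 0 -> 0 < dotv x x.
Proof. by move=> x0; rewrite lt_def dotv_ge0 andbT; apply: contra_neq x0 => /dotv_eq0. Qed.

Lemma cauchy_schwarz x y : dotv x y ^+ 2 <= dotv x x * dotv y y.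
Proof.
have [->|y0] := eqVneq y 0.
  have z : dotv x 0 = 0 by have := dotvZr 0 x 0; rewrite scale0r mul0r.
  by rewrite z expr0n /= mulr_ge0 ?dotv_ge0.
have yy := dotv_gt0 y0.
have := dotv_ge0 (dotv y y *: x - dotv x y *: y).
rewrite !(dotvBl, dotvBr, dotvZl, dotvZr) (dotvC y x) => h.
rewrite -subr_ge0 -(pmulr_rge0 _ yy); apply: le_trans h _.
by rewrite le_eqVlt; apply/orP; left; apply/eqP; ring.
Qed.

Lemma dotv_unit_bound x y : dotv x x = 1 -> dotv y y = 1 -> -1 <= dotv x y <= 1.
Proof.
move=> x1 y1; have := cauchy_schwarz x y; rewrite x1 y1 mulr1 => h.
by rewrite -ler_norml -(@ler_pXn2r _ 2) ?nnegrE // expr1n real_normK ?num_real.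
Qed.

Lemma cvg_dotv (T : Type) (F : set_system T) {FF : Filter F} (f g : T -> 'rV[R]_n) x y :
  f @ F --> x -> g @ F --> y -> dotv (f t) (g t) @[t --> F] --> dotv x y.
Proof.
move=> fx gy; apply: cvg_big => [|i _]; first exact: add_continuous.
apply: cvgM.
  exact: (cvg_comp _ _ fx (@coord_continuous R 1 n 0 i x)).
exact: (cvg_comp _ _ gy (@coord_continuous R 1 n 0 i y)).
Qed.

Lemma continuous_dotvr z : continuous (fun x => dotv z x).
Proof. by move=> x; apply: (@cvg_dotv _ (nbhs x) _ (fun=> z) id); [exact: cvg_cst | exact: cvg_id]. Qed.

End DotProduct.

Section Polytope.
Variables (R : realType) (n : nat).
Implicit Types (P V : set 'rV[R]_n) (x y z c : 'rV[R]_n).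

Definition simplex N : set 'rV[R]_N :=
  [set w | (forall i, 0 <= w 0 i) /\ \sum_(i < N) w 0 i = 1].

Arguments simplex : clear implicits.

Definition combination N (v : 'I_N -> 'rV[R]_n) (w : 'rV[R]_N) : 'rV[R]_n :=
  \sum_(i < N) w 0 i *: v i.

Lemma compact_simplex N : compact (simplex N).
Proof.
apply: bounded_closed_compact.
  exists 1; split; first exact: num_real.
  move=> M M1 w /= [w0 w1]; apply: le_trans (ltW M1).
  rewrite -[`|w|]/(mx_norm w) mx_normrE; apply: bigmax_le => // -[i j] _ /=.
  rewrite (ord1 i) ger0_norm // -w1 (bigD1 j) //= lerDl.
  by apply: sumr_ge0 => k _; exact: w0.
rewrite (_ : simplex N = (fun w : 'rV[R]_N => \sum_(i < N) w 0 i) @^-1` [set s | s = 1] `&`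
   \bigcap_(i in @setT 'I_N) (fun w : 'rV[R]_N => w 0 i) @^-1` [set s | 0 <= s]); last first.
  apply/seteqP; split=> w /=; first by move=> [w0 w1]; split=> // i _; exact: w0.
  by move=> [w1 w0]; split=> // i; exact: w0.
apply: closedI.
  apply: preimage_closed; last exact: closed_eq.
  move=> w _; apply: cvg_big; [exact: add_continuous | exact: mx_nbhs_filter | move=> i _].
  exact: (@coord_continuous R 1 N 0 i w).
apply: closed_bigI => i _; apply: preimage_closed; last exact: closed_ge.
by move=> w _; exact: coord_continuous.
Qed.

(** Collecting weights by vertex turns combinations of any length into combinations of fixed length,
    so a polytope is a continuous image of a simplex. *)
Lemma convex_hull_simplex V : finite_set V ->
  exists N (v : 'I_N -> 'rV[R]_n), convex_hull V = combination v @` simplex N.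
Proof.
move=> /finite_seqP[s Vs]; exists (size s), (fun i => nth 0 s i).
apply/seteqP; split=> x.
  move=> [k [p [w [pV w0 w1 ->]]]].
  have ps i : p i \in s by have := pV i; rewrite Vs.
  have ips i : (index (p i) s < size s)%N by rewrite index_mem.
  pose phi i := Ordinal (ips i).
  exists (\row_j \sum_(i < k | phi i == j) w i).
    split=> [j|]; first by rewrite mxE sumr_ge0.
    under eq_bigr do rewrite mxE.
    by rewrite -w1 (partition_big phi xpredT).
  rewrite /combination [RHS](partition_big phi xpredT) //=.
  apply: eq_bigr => j _; rewrite mxE scaler_suml; apply: eq_bigr => i /eqP <-.
  by rewrite /= nth_index.
move=> [w [w0 w1] <-].
exists (size s), (fun i : 'I_(size s) => nth 0 s i), (fun i => w 0 i); split=> //.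
by move=> i; rewrite Vs /= mem_nth.
Qed.

Lemma compact_polytope P : is_polytope P -> compact P.
Proof.
move=> [V finV ->]; have [N [v ->]] := convex_hull_simplex finV.
apply: continuous_compact; last exact: compact_simplex.
apply: continuous_subspaceT => w; apply: cvg_big; [exact: add_continuous | exact: mx_nbhs_filter | move=> i _].
by apply: cvgZr_tmp; [exact: mx_nbhs_filter | exact: (@coord_continuous R 1 N 0 i w)].
Qed.

Lemma convex_polytope P x y (t : R) : is_polytope P -> P x -> P y -> 0 <= t <= 1 ->
  P (x + t *: (y - x)).
Proof.
move=> [V finV ->]; have [N [v ->]] := convex_hull_simplex finV.
move=> [a [a0 a1] <-] [b [b0 b1] <-] /andP[t0 t1].
exists ((1 - t) *: a + t *: b); first split=> [i|].
- by rewrite !mxE addr_ge0 // mulr_ge0 ?subr_ge0.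
- under eq_bigr do rewrite !mxE.
  by rewrite big_split /= -!mulr_sumr a1 b1 !mulr1 subrK.
rewrite /combination scalerBr !scaler_sumr -sumrB -big_split /=.
apply: eq_bigr => i _; rewrite !mxE !scalerA -scalerBl -scalerDl.
by congr (_ *: _); ring.
Qed.

(** [q] is the point of [P] nearest to [y]; an [x] violating the inequality would give a nearer
    point on the segment from [q] to [x]. *)
Lemma polytope_projection P y : is_polytope P -> P !=set0 -> exists2 q, P q &
  forall x, P x -> dotv (y - q) (x - q) <= 0.
Proof.
move=> polyP P0.
have cont : {within P, continuous (fun z => dotv (y - z) (y - z))}.
  apply: continuous_subspaceT => z.
  have cB : (y - t) @[t --> z] --> y - z.
    exact: (cvgB (cvg_cst _) cvg_id).
  exact: (cvg_dotv cB cB).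
have [q] := EVT_min_rV P0 (compact_polytope polyP) cont.
rewrite inE => Pq qmin; exists q => // x Px; rewrite leNgt; apply/negP => s0.
set s := dotv (y - q) (x - q) in s0.
set L := dotv (x - q) (x - q); have L0 : 0 <= L := dotv_ge0 _.
(* Minimality at parameter [t] yields [2 * s <= t * L], whereas this [t] satisfies
   [t * L = s - t * s < s]. *)
pose t := s / (s + L); have sL : 0 < s + L by lra.
have t0 : 0 < t by rewrite divr_gt0.
have t1 : t <= 1 by rewrite ler_pdivrMr // mul1r; lra.
have t01 : 0 <= t <= 1 by rewrite (ltW t0).
have := qmin (q + t *: (x - q)); rewrite inE => /(_ (convex_polytope polyP Pq Px t01)).
rewrite opprD addrA !(dotvBl _ (t *: _)) !(dotvBr _ _ (t *: _)) !dotvZr !dotvZl.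
rewrite (dotvC (x - q) (y - q)) -/s -/L => h.
have : 2 * s <= t * L by rewrite -(ler_pM2l t0); lra.
have : t * (s + L) = s by rewrite /t divfK // gt_eqF.
rewrite mulrDr => e; have : 0 < t * s by rewrite mulr_gt0.
by lra.
Qed.

(* The unit vectors of the linear span of [P - p], described as a double orthogonal. *)
Definition unit_directions P p : set 'rV[R]_n :=
  [set c | dotv c c = 1 /\
    forall z, (forall x, P x -> dotv z (x - p) = 0) -> dotv z c = 0].

Lemma compact_unit_directions P p : compact (unit_directions P p).
Proof.
rewrite (_ : unit_directions P p = @unit_sphere R n `&`
   \bigcap_(z in [set z | forall x, P x -> dotv z (x - p) = 0])
     (fun c => dotv z c) @^-1` [set s | s = 0]); last first.
  by apply/seteqP; split=> c /= [].
apply: compact_closedI; first exact: compact_unit_sphere.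
apply: closed_bigI => z _; apply: preimage_closed; last exact: closed_eq.
by move=> c _; exact: continuous_dotvr.
Qed.

Lemma affine_hull_dotv P p y z : P p -> affine_hull P y ->
  (forall x, P x -> dotv z (x - p) = 0) -> dotv z (y - p) = 0.
Proof.
move=> Pp [k [a [w [aP w1 ->]]]] zP; rewrite dotvBr dotv_sumr.
rewrite (eq_bigr (fun i => w i * dotv z p)).
  by rewrite -mulr_suml w1 mul1r subrr.
move=> i _; congr (_ * _); apply/eqP; rewrite -subr_eq0 -dotvBr.
by rewrite zP.
Qed.

(** Otherwise, by compactness, [P] extends beyond [p] by a uniform [mu] in every unit direction of
    its span. A point of the affine hull closer than [mu] to [p] then lies in [P], or the direction
    from its projection would be violated; so [p] is relatively interior. *)
Lemma exists_support P p : is_polytope P -> relative_boundary P p ->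
  exists2 c, unit_directions P p c & forall x, P x -> dotv c (x - p) <= 0.
Proof.
move=> polyP [Pp pN]; apply: contrapT => no_c; apply: pN; split=> //.
have pos c : unit_directions P p c -> exists2 x, P x & 0 < dotv c (x - p).
  move=> cP; apply: contrapT => h; apply: no_c; exists c => // x Px.
  by rewrite leNgt; apply/negP => x0; apply: h; exists x.
have [mu mu0 muP] : exists2 mu : R, 0 < mu & forall c, unit_directions P p c ->
    exists2 x, P x & mu <= dotv c (x - p).
  have /compact_near_coveringP/near_covering_withinP cC := @compact_unit_directions P p.
  have cover : forall c, unit_directions P p c -> \forall c' \near c & mu \near 0^'+,
      unit_directions P p c' -> exists2 x, P x & mu <= dotv c' (x - p).
    move=> c /pos[x Px x0].
    have cont : dotv c' (x - p) @[c' --> c] --> dotv c (x - p).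
      rewrite (dotvC c); under eq_fun do rewrite dotvC.
      exact: (@continuous_dotvr _ _ (x - p) c).
    have x20 : dotv c (x - p) / 2 < dotv c (x - p) by lra.
    have near_c := cvgr_gt _ cont _ x20.
    exists ([set c' | dotv c (x - p) / 2 < dotv c' (x - p)], [set mu | mu < dotv c (x - p) / 2]) => /=.
      by split; [exact: near_c | apply: nbhs_right_lt; lra].
    by move=> [c' mu] /= [h1 h2] _; exists x => //; lra.
  have near0 := cC R (0^'+) (fun mu c => exists2 x, P x & mu <= dotv c (x - p)) _ cover.
  have [mu [muP mu0]] := @filter_ex _ (0 : R)^'+ _ _ (filterI (near0 _) (nbhs_right_gt 0)).
  by exists mu.
have cont : dotv (y - p) (y - p) @[y --> p] --> dotv (p - p) (p - p).
  have cB : (y - p) @[y --> p] --> p - p by exact: (cvgB cvg_id (cvg_cst _)).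
  exact: (cvg_dotv cB cB).
have mu20 : dotv (p - p) (p - p) < mu ^+ 2.
  by rewrite dotvBr subrr exprn_gt0.
have near_p : \forall y \near p, dotv (y - p) (y - p) < mu ^+ 2.
  exact: (cvgr_lt _ cont _ mu20).
move: near_p; apply: filterS => y yp affy; apply: contrapT => yN.
have [q Pq qP] := polytope_projection y polyP (ex_intro _ p Pp).
have yq : y - q != 0.
  by apply/negP => /eqP/subr0_eq yq; apply: yN; rewrite yq.
pose rho := Num.sqrt (dotv (y - q) (y - q)).
have rho0 : 0 < rho by rewrite sqrtr_gt0 dotv_gt0.
have rho2 : dotv (y - q) (y - q) = rho ^+ 2 by rewrite sqr_sqrtr // dotv_ge0.
have cD : unit_directions P p (rho^-1 *: (y - q)).
  split; first by rewrite dotvZl dotvZr rho2; field; rewrite gt_eqF.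
  move=> z zP; rewrite dotvZr.
  have -> : y - q = (y - p) - (q - p) by rewrite opprB addrA subrK.
  by rewrite dotvBr (affine_hull_dotv Pp affy zP) zP // subrr mulr0.
have [x Px] := muP _ cD; rewrite dotvZl leNgt => /negP; apply.
(* Paired with the unit vector along [y - q], the first part is nonpositive by projection, the
   second subtracts a positive length, and the third stays below [mu]. *)
have -> : x - p = (x - q) - (y - q) + (y - p).
  by apply/rowP => i; rewrite !mxE; ring.
rewrite dotvDr dotvBr rho2 mulrDr.
have yp2 : rho^-1 * dotv (y - q) (y - p) < mu.
  rewrite -dotvZl; have := cauchy_schwarz (rho^-1 *: (y - q)) (y - p).
  rewrite (cD.1) mul1r => /le_lt_trans/(_ yp); set u := dotv _ _ => u2.
  rewrite ltNge; apply/negP => muu; move: u2; rewrite ltNge => /negP; apply.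
  by rewrite ler_pXn2r ?nnegrE //; lra.
have : rho^-1 * (dotv (y - q) (x - q) - rho ^+ 2) <= 0.
  rewrite pmulr_rle0 ?invr_gt0 //.
  by have := qP _ Px; have := sqr_ge0 rho; lra.
by lra.
Qed.

(** The supporting functional cuts out the face. If it were constant on [P], the unit vector [c]
    would be orthogonal to the span that contains it. *)
Lemma exists_proper_face P p : is_polytope P -> relative_boundary P p ->
  exists2 F, is_proper_face P F & F p.
Proof.
move=> polyP pB; have [c [c1 cP] csup] := exists_support polyP pB; have Pp := pB.1.
exists [set x | P x /\ dotv c x = dotv c p]; last by split.
split.
  exists c, (dotv c p); split=> // x Px.
  by have := csup x Px; rewrite dotvBr subr_le0.
move=> FP; have := cP c; rewrite c1 => h; have : (1 : R) = 0.
  apply: h => x; rewrite -FP /= => -[_ e].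
  by rewrite dotvBr e subrr.
by apply/eqP; exact: oner_neq0.
Qed.

(** From a point [y] of [P] off the face, prolonging the segment slightly beyond a relatively
    interior [v] of the face would stay in [P] and exceed [b]. *)
Lemma proper_face_boundary P F : is_proper_face P F -> F `<=` relative_boundary P.
Proof.
move=> [[c [b [cb FE]]] FP] v; rewrite FE /= => -[Pv cv]; split=> // -[_ near_v].
have [y [Py cy]] : exists y, P y /\ dotv c y < b.
  apply: contrapT => h; apply: FP; rewrite FE; apply/seteqP; split=> [x []//|x Px].
  split=> //; apply/eqP; rewrite eq_le cb //= leNgt; apply/negP => xb.
  by apply: h; exists x.
have cont : (v + t *: (v - y)) @[t --> (0 : R)] --> v + 0 *: (v - y).
  apply: (@cvgD _ _ _ (nbhs (0 : R)) _ (fun=> v) (fun t => t *: (v - y))).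
    exact: cvg_cst.
  by apply: (@cvgZr_tmp _ _ _ (nbhs (0 : R)) _ id); exact: cvg_id.
have := cont (fun y => affine_hull P y -> P y).
rewrite scale0r addr0 => /(_ near_v) near_t.
have near_t' : \forall t \near (0 : R)^'+, affine_hull P (v + t *: (v - y)) -> P (v + t *: (v - y)).
  by apply: (@filterS _ (nbhs (0 : R)) _ _ _ _ near_t) => t tP _; exact: tP.
have [t [tP t0]] := @filter_ex _ (0 : R)^'+ _ _ (filterI near_t' (nbhs_right_gt 0)).
have /cb : P (v + t *: (v - y)).
  apply: tP; exists 2%N, (fun i : 'I_2 => if i == ord0 then v else y),
    (fun i : 'I_2 => if i == ord0 then 1 + t else - t); split.
  - by move=> i; case: ifP.
  - by rewrite !big_ord_recl big_ord0 /=; ring.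
  rewrite !big_ord_recl big_ord0 /= addr0 scalerBr scalerDl scale1r scaleNr.
  by rewrite addrA.
rewrite dotvDr dotvZr dotvBr cv leNgt => /negP; apply.
by rewrite ltrDl mulr_gt0 // subr_gt0.
Qed.

End Polytope.

(** * Spherical geometry *)

Lemma within_continuous_compose (T U W : topologicalType) (A : set T) (B : set U)
    (g : T -> U) (f : U -> W) :
  {within A, continuous g} -> (forall x, A x -> B (g x)) ->
  {within B, continuous f} -> {within A, continuous (f \o g)}.
Proof.
move=> /subspace_continuousP cg AB /subspace_continuousP cf.
apply/subspace_continuousP => x Ax S /(cf _ (AB _ Ax)) /(cg _ Ax) near_x.
apply: (@filterS _ (nbhs x) _ _ _ _ near_x) => y yP Ay.
by apply: (yP Ay); exact: AB.
Qed.

Section Sphere.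
Variables (R : realType) (m : nat).
Implicit Types (x y v : 'rV[R]_m).

(* Cauchy-Schwarz for the components of [x] and [y] orthogonal to [v]. *)
Lemma spherical_triangle x y v : unit_sphere x -> unit_sphere y -> unit_sphere v ->
  cos (spherical_dist x v + spherical_dist v y) <= dotv x y.
Proof.
rewrite /unit_sphere /= => x1 y1 v1; rewrite /spherical_dist cosD.
have xv := dotv_unit_bound x1 v1; have vy := dotv_unit_bound v1 y1.
rewrite !acosK ?in_itv //= !sin_acos //.
set a := dotv x v in xv *; set b := dotv v y in vy *.
have a2 : 0 <= 1 - a ^+ 2 by move: xv => /andP[? ?]; nra.
have b2 : 0 <= 1 - b ^+ 2 by move: vy => /andP[? ?]; nra.
have := cauchy_schwarz (x - a *: v) (y - b *: v).
rewrite !(dotvBl, dotvBr, dotvZl, dotvZr) x1 y1 v1 (dotvC v x) (dotvC y v) -/a -/b => cs.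
rewrite -sqrtrM // lerBlDl -lerBlDr.
have {cs}: (a * b - dotv x y) ^+ 2 <= (1 - a ^+ 2) * (1 - b ^+ 2).
  by apply: le_trans (le_trans _ cs) _; rewrite le_eqVlt; apply/orP; left; apply/eqP; ring.
move=> cs; apply: le_trans (ler_norm _) _.
by rewrite -sqrtr_sqr; exact: ler_wsqrtr.
Qed.

Lemma spherical_dist_le_diam (A : set 'rV[R]_m) x y :
  A `<=` @unit_sphere R m -> A x -> A y -> spherical_dist x y <= spherical_diam A.
Proof.
move=> AS Ax Ay; apply: ub_le_sup; last by exists x => //; exists y.
exists pi => _ [u Au [w Aw <-]].
by apply: acos_lepi; apply: dotv_unit_bound; exact: AS.
Qed.

(** Replacing [j] by [r - j] if necessary puts the angle between [2 pi / r] and [pi], where the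
    cosine decreases. *)
Lemma cos_turn_le r j : prime r -> (0 < j < r)%N ->
  cos (turn r j%:R : R) <= cos (pi *+ 2 / r%:R).
Proof.
move=> r_prime /andP[j0 jr]; have r0 : 0 < r%:R :> R by rewrite ltr0n prime_gt0.
have pi0 := pi_gt0 R.
have half k : (0 < k)%N -> (k.*2 <= r)%N ->
    cos (turn r k%:R : R) <= cos (pi *+ 2 / r%:R).
  move=> k0 kr.
  have k1 : 1 <= k%:R :> R by rewrite ler1n.
  have k2 : k%:R * 2 <= r%:R :> R by rewrite -natrM muln2 ler_nat.
  have in0pi (t : R) : 0 <= t -> t * 2 <= r%:R -> pi *+ 2 * (t / r%:R) \in `[0, (pi : R)].
    move=> t0 tr; rewrite in_itv /= mulrA; apply/andP; split.
      by rewrite divr_ge0 ?ler0n // mulr_ge0 // mulrn_wge0 // ltW.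
    by rewrite ler_pdivrMr //; have := ler_wpM2l (ltW pi0) tr; lra.
  rewrite leNgt -[pi *+ 2 / _](mul1r) /turn.
  have -> : 1 * (pi *+ 2 / r%:R) = pi *+ 2 * (1 / r%:R) :> R by ring.
  rewrite ltr_cos; last 2 first.
  - by apply: in0pi => //; lra.
  - by apply: in0pi; lra.
  rewrite -leNgt; apply: ler_wpM2l; first by rewrite mulrn_wge0 // ltW.
  by apply: ler_wpM2r => //; rewrite invr_ge0 ltW.
have [jr2|jr2] := leqP j.*2 r; first exact: half.
have -> : cos (turn r j%:R : R) = cos (turn r (r - j)%:R).
  rewrite natrB; last exact: ltnW.
  have -> : turn r (r%:R - j%:R) = - turn r j%:R + pi *+ 2 :> R.
    by rewrite /turn; field; rewrite gt_eqF.
  by rewrite cosD2pi cosN.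
by apply: half; lia.
Qed.

Lemma dotv_row_of_rotate r p i j (x : nat -> R) : (p.*2 <= m)%N -> (i <= j)%N ->
  on_sphere p.*2 x ->
  dotv (row_of m (rotate r i x)) (row_of m (rotate r j x)) = cos (turn r (j - i)%:R).
Proof.
move=> pm ij xp; have yp := on_sphere_rotate r i xp.
rewrite -(dot_rotate r (j - i) yp) rotateD subnK // /dotv.
transitivity (\sum_(k < m) rotate r i x k * rotate r j x k).
  by apply: eq_bigr => k _; rewrite !mxE.
rewrite -(subnKC pm) big_split_ord /= [X in _ + X]big1 ?addr0 // => k _.
by rewrite (yp.1 _ (leq_addr _ _)) mul0r.
Qed.

End Sphere.

Theorem theorem3p1 (R : realType) (d r m n : nat)
    (P : set 'rV[R]_n) (h : 'rV[R]_n -> 'rV[R]_m) (f : 'rV[R]_n -> 'rV[R]_d)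
    (d_gt0 : (0 < d)%N) (r_prime : prime r) (m_ge : ((r - 1) * d + 2 <= m)%N)
    (P_polytope : is_polytope P) (P_dim : has_affine_dim P m)
    (h_homeo : is_homeomorphism (relative_boundary P) (@unit_sphere R m) h)
    (face_diam : forall F : set 'rV[R]_n, is_proper_face P F ->
       spherical_diam (h @` F) < pi / r%:R)
    (f_cont : {within P, continuous f}) :
  exists F : 'I_r -> set 'rV[R]_n,
    [/\ forall i, is_face P (F i),
        forall i j, i != j -> vertex_disjoint P (F i) (F j)
      & exists y : 'rV[R]_d, forall i, (f @` F i) y].
Proof.
have [[hfun hinj hsurj] _ [g [g_cont gK]]] := h_homeo.
have gB y : unit_sphere y -> relative_boundary P (g y) /\ h (g y) = y.
  by move=> /hsurj[x xB <-]; rewrite gK.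
have G_cont : {within @unit_sphere R m, continuous (f \o g)}.
  by apply: (within_continuous_compose g_cont _ f_cont) => y /gB[[]].
have md : (d * r.-1 + 2 <= m)%N by rewrite mulnC -subn1.
have [x [xp xG]] := equivariant_coincidence r_prime md G_cont.
set p := (d * r.-1)./2.+1 in xp.
have pm : (p.*2 <= m)%N by rewrite /p; lia.
pose z (i : nat) := row_of m (rotate r i x).
have zS i : unit_sphere (z i) by apply: (row_of_sphere pm); exact: on_sphere_rotate.
have face i : exists F, is_proper_face P F /\ F (g (z i)).
  by have [F] := exists_proper_face P_polytope (gB _ (zS i)).1; exists F.
have [F FP] := choice face.
exists (fun i : 'I_r => F i); split=> [i|i j ij|]; first exact: (FP i).1.1.
- have disjoint (k l : nat) : (k < l < r)%N -> vertices P `&` F k `&` F l = set0.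
    move=> /andP[kl lr]; rewrite -subset0 => v [[_ vk] vl] /=.
    have FB q : h @` F q `<=` @unit_sphere R m.
      by move=> _ [w /(proper_face_boundary (FP q).1) wB <-]; exact: hfun.
    have hz q : (h @` F q) (z q) by exists (g (z q)); [exact: (FP q).2 | exact: (gB _ (zS q)).2].
    have hvk : (h @` F k) (h v) by exists v.
    have hvl : (h @` F l) (h v) by exists v.
    have d1 := le_lt_trans (spherical_dist_le_diam (FB k) (hz k) hvk) (face_diam _ (FP k).1).
    have d2 := le_lt_trans (spherical_dist_le_diam (FB l) hvl (hz l)) (face_diam _ (FP l).1).
    have vS := FB k _ hvk.
    have := spherical_triangle (zS k) (zS l) vS.
    rewrite (dotv_row_of_rotate r pm (ltnW kl) xp).
    have jr : (0 < l - k < r)%N by lia.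
    (* The distances from [h v] to [z k] and [z l] add up to less than [2 pi / r], which is at most
       [pi] because [r >= 2]. Monotonicity of the cosine on [0, pi] then contradicts this
       inequality. *)
    move=> /le_trans/(_ (cos_turn_le R r_prime jr)).
    have r2 : 2 <= r%:R :> R by rewrite ler_nat prime_gt1.
    have a0 := acos_ge0 (dotv_unit_bound (zS k) vS).
    have b0 := acos_ge0 (dotv_unit_bound vS (zS l)).
    have pi0 := pi_gt0 R.
    have rpi : pi *+ 2 / r%:R <= pi :> R.
      by rewrite ler_pdivrMr ?ltr0n ?prime_gt0 //; have := ler_wpM2l (ltW pi0) r2; lra.
    have e : pi *+ 2 / r%:R = pi / r%:R + pi / r%:R :> R by rewrite mulr2n mulrDl.
    rewrite leNgt ltr_cos ?in_itv /=.
    + by rewrite e => /negP; apply; rewrite /spherical_dist in d1 d2 *; lra.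
    + by move: d1 d2; rewrite /spherical_dist => d1 d2; apply/andP; split; lra.
    + by apply/andP; split=> //; rewrite divr_ge0 ?ler0n // mulrn_wge0 // ltW.
  rewrite /vertex_disjoint; have [ltij|ltji|eij] := ltngtP i j.
  + by apply: disjoint; rewrite ltij ltn_ord.
  + by rewrite setIAC; apply: disjoint; rewrite ltji ltn_ord.
  by move: ij; rewrite (val_inj eij) eqxx.
exists (f (g (z 0%N))) => i; exists (g (z i)); first exact: (FP i).2.
(* The coincidence is indexed by ['F_r]; for [i < r] the residue of [i] has value [i]. *)
by have := xG (i%:R : 'F_r) 0; rewrite /= val_Fp_nat // modn_small.
Qed.
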